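(* Let $\{\phi_m\}_{m\in\Lambda}$ be a frame for $L^2(\mathbb{R}^d)$, and for $m,n\in\Lambda$ let $\Phi_{m,n}=\phi_m\otimes\overline{\phi_n}$, i.e. $\Phi_{m,n}(t,y)=\phi_m(t)\overline{\phi_n(y)}$ for $t,y\in\mathbb{R}^d$. Let $A$ be an integral operator with kernel $k$ and let $p\in[1,2]$. If $$\biggl(\sum_{n\in\Lambda}\biggl(\sum_{m\in\Lambda}|\langle k,\Phi_{m,n}\rangle|^2\biggr)^{p/2}\biggr)^{1/p}<\infty,$$ then $A$ is Schatten $p$-class on $L^2(\mathbb{R}^d)$.
   Context: An integral operator with kernel $k$ (a function on $\mathbb{R}^d\times\mathbb{R}^d$) is an operator of the form $Af(t)=\int_{\mathbb{R}^d}k(t,y)f(y)\,dy$. The pairing is $\langle k,\Phi\rangle=\iint k(t,y)\overline{\Phi(t,y)}\,dt\,dy$, so that $\langle k,\Phi_{m,n}\rangle=\langle A\phi_n,\phi_m\rangle$. A frame for a Hilbert space $H$ is a sequence $\{\phi_x\}_{x\in\Lambda}$ in $H$ for which there are $B_1,B_2>0$ with $B_1\|f\|^2\le\sum_{x\in\Lambda}|\langle f,\phi_x\rangle|^2\le B_2\|f\|^2$ for all $f\in H$. A linear operator $A:H\to H$ on a Hilbert space $H$ is Schatten $p$-class, written $A\in\mathcal{I}_p(H)$, if $\|A\|_{\mathcal{I}_p}=\sup\bigl(\sum_{n\in\mathbb{N}}|\langle Af_n,g_n\rangle|^p\bigr)^{1/p}<\infty$, where the supremum is over all pairs of orthonormal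 sequences $\{f_n\}_{n\in\mathbb{N}}$, $\{g_n\}_{n\in\mathbb{N}}$ in $H$. *)

(* Defs.v *)
From HB Require Import structures.
From mathcomp Require Import all_boot all_order all_algebra.
From mathcomp Require Import complex.
From mathcomp Require Import all_classical all_reals all_analysis.

Set Implicit Arguments.
Unset Strict Implicit.
Unset Printing Implicit Defensive.

Import Order.TTheory GRing.Theory Num.Theory.
Import numFieldNormedType.Exports.
Import ComplexField.Normc.

Local Open Scope classical_set_scope.
Local Open Scope ring_scope.

Section complex_integration.
Context d (T : measurableType d) (R : realType).

Definition cmeasurable (f : T -> R[i]) : Prop :=
  measurable_fun [set: T] (fun x => complex.Re (f x)) /\
  measurable_fun [set: T] (fun x => complex.Im (f x)).

Variable mu : {measure set T -> \bar R}.

Definition cintegrable (f : T -> R[i]) : Prop :=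
  mu.-integrable [set: T] (fun x => (complex.Re (f x))%:E) /\
  mu.-integrable [set: T] (fun x => (complex.Im (f x))%:E).

Definition cintegral (f : T -> R[i]) : R[i] :=
  Complex (\int[mu]_x complex.Re (f x)) (\int[mu]_x complex.Im (f x)).

End complex_integration.

(* Elements of L^2(mu) are represented by measurable square-integrable
   functions, equality in L^2(mu) being equality mu-almost everywhere. *)
Section L2.
Context d (T : measurableType d) (R : realType).
Variable mu : {measure set T -> \bar R}.
Implicit Types (f g : T -> R[i]) (A : (T -> R[i]) -> (T -> R[i])).

Definition sqnorm f : \bar R := (\int[mu]_x (normc (f x) ^+ 2)%:E)%E.

Definition L2 f : Prop := cmeasurable f /\ (sqnorm f < +oo)%E.

Definition inner f g : R[i] := cintegral mu (fun x => f x * conjc (g x)).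

Definition frame (I : countType) (phi : I -> T -> R[i]) : Prop :=
  (forall x, L2 (phi x)) /\
  exists B1 B2 : R, [/\ 0 < B1, 0 < B2 &
    forall f, L2 f ->
      (B1%:E * sqnorm f <=
         \esum_(x in [set: I]) (normc (inner f (phi x)) ^+ 2)%:E)%E /\
      (\esum_(x in [set: I]) (normc (inner f (phi x)) ^+ 2)%:E <=
         B2%:E * sqnorm f)%E].

Definition orthonormal_seq (f : nat -> T -> R[i]) : Prop :=
  (forall n, L2 (f n)) /\ (forall m n, inner (f m) (f n) = (m == n)%:R).

(* A induces a linear operator on the quotient L^2(mu); its values outside
   L^2(mu) are irrelevant. *)
Definition linear_operator A : Prop :=
  [/\ forall f, L2 f -> L2 (A f),
      forall f g, L2 f -> L2 g ->
        {ae mu, forall x, f x = g x} -> {ae mu, forall x, A f x = A g x} &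
      forall (a : R[i]) f g, L2 f -> L2 g ->
        {ae mu, forall x, A (fun y => a * f y + g y) x = a * A f x + A g x}].

Definition schatten_norm (p : R) A : \bar R :=
  ereal_sup [set s | exists f g : nat -> T -> R[i],
    [/\ orthonormal_seq f, orthonormal_seq g &
        s = ((\sum_(0 <= n <oo) (normc (inner (A (f n)) (g n)) `^ p)%:E)
             `^ p^-1)%E]].

Definition schatten_class (p : R) A : Prop :=
  linear_operator A /\ (schatten_norm p A < +oo)%E.

(* The operator f |-> \int k(t, y) f(y) dy on L^2(mu), the integral converging
   absolutely for almost every t (where the null set may depend on f).
   Linearity and compatibility with a.e. equality follow. *)
Definition integral_operator (k : T * T -> R[i]) A : Prop :=
  cmeasurable k /\
  forall f, L2 f -> L2 (A f) /\
    {ae mu, forall t, cintegrable mu (fun y => k (t, y) * f y) /\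
                      A f t = cintegral mu (fun y => k (t, y) * f y)}.

(* The double integral is iterated, with y innermost: for an integral operator
   k this converges when Psi = f (x) conj g with f, g in L^2(mu), and equals
   <A g, f>, even when k * conj Psi is not integrable for mu (x) mu; when it is,
   this is the integral against the product measure by Fubini's theorem. *)
Definition pairing (k Psi : T * T -> R[i]) : R[i] :=
  cintegral mu (fun t => cintegral mu (fun y => k (t, y) * conjc (Psi (t, y)))).

Definition tensor f g : T * T -> R[i] := fun z => f z.1 * g z.2.

End L2.

Lemma product_sigma_finite d1 d2 (T1 : measurableType d1)
    (T2 : measurableType d2) (R : realType)
    (m1 : {sigma_finite_measure set T1 -> \bar R})
    (m2 : {sigma_finite_measure set T2 -> \bar R}) :
  sigma_finite setT (m1 \x m2)%E.
Proof.
have /sigma_finiteP[F [TF ndF Foo]] := sigma_finiteT m1.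
have /sigma_finiteP[G [TG ndG Goo]] := sigma_finiteT m2.
exists (fun n => F n `*` G n).
  rewrite -setXTT TF TG predeqE => -[x y]; split.
    move=> [/= [n _ Fnx] [k _ Gky]]; exists (maxn n k) => //; split.
    - by move: x Fnx; exact/subsetPset/ndF/leq_maxl.
    - by move: y Gky; exact/subsetPset/ndG/leq_maxr.
  by move=> [n _ []/= ? ?]; split; exists n.
move=> k; have [? ?] := Foo k; have [? ?] := Goo k.
split; first exact: measurableX.
by rewrite product_measure1E// lte_mul_pinfty// ge0_fin_numE.
Qed.

(* Lebesgue measure on R^n, the type of n-tuples: a unit mass at the point of
   R^0, and the image of the product measure under (x, v) |-> x :: v on
   R^(n+1). *)
Section lebesgue_measure_Rn.
Variable R : realType.

Definition Rn (n : nat) := n.-tuple (measurableTypeR R).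

Definition tcons n (z : measurableTypeR R * Rn n) : Rn n.+1 :=
  [tuple of z.1 :: z.2].

Lemma measurable_tcons n : measurable_fun [set: _] (@tcons n).
Proof.
exact: (@measurable_cons _ _ (measurableTypeR R * Rn n)%type
  (measurableTypeR R) fst n snd).
Qed.

Section step.
Variables (n : nat) (mu : {sigma_finite_measure set (Rn n) -> \bar R}).

Definition lebesgue_step : set (Rn n.+1) -> \bar R :=
  pushforward (@lebesgue_measure R \x mu)%E (@tcons n).

Let step0 : lebesgue_step set0 = 0%E.
Proof. by rewrite /lebesgue_step /pushforward preimage_set0 measure0. Qed.

Let step_ge0 A : (0 <= lebesgue_step A)%E.
Proof. by rewrite /lebesgue_step /pushforward measure_ge0. Qed.

Let step_sigma_additive : semi_sigma_additive lebesgue_step.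
Proof.
move=> F mF tF mUF; rewrite /lebesgue_step /pushforward preimage_bigcup.
apply: measure_semi_sigma_additive.
- by move=> i; rewrite -[X in measurable X]setTI; exact: measurable_tcons.
- apply/trivIsetP => /= i j _ _ ij; rewrite -preimage_setI.
  by move/trivIsetP : tF => /(_ _ _ _ _ ij) ->//; rewrite preimage_set0.
- rewrite -preimage_bigcup -[X in measurable X]setTI.
  exact: measurable_tcons.
Qed.

HB.instance Definition _ := isMeasure.Build _ _ _ lebesgue_step
  step0 step_ge0 step_sigma_additive.

Let tuncons (v : Rn n.+1) : measurableTypeR R * Rn n :=
  (thead v, [tuple of behead v]).

Let tconsK : cancel (@tcons n) tuncons.
Proof. by case=> x v; congr pair; apply/val_inj. Qed.

Let measurable_tuncons : measurable_fun [set: _] tuncons.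
Proof.
apply/measurable_fun_pairP; split.
  exact: (@measurable_tnth _ (measurableTypeR R) n.+1 ord0).
exact: (@measurable_behead _ (measurableTypeR R) n).
Qed.

Let step_sigma_finite : sigma_finite setT lebesgue_step.
Proof.
have [F TF mF] := product_sigma_finite (@lebesgue_measure R) mu.
exists (fun i => tuncons @^-1` F i).
  by rewrite -preimage_bigcup -TF preimage_setT.
move=> i; have [mFi Fi] := mF i; split.
  by rewrite -[X in measurable X]setTI; exact: measurable_tuncons.
rewrite /lebesgue_step /pushforward -comp_preimage.
by rewrite (_ : tuncons \o _ = id) ?preimage_id//; apply/funext => z /=.
Qed.

HB.instance Definition _ := Measure_isSigmaFinite.Build _ _ _ lebesgue_step
  step_sigma_finite.

End step.

Fixpoint lebesgue_Rn (n : nat) : {sigma_finite_measure set (Rn n) -> \bar R} :=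
  match n with
  | 0 => \d_([tuple] : Rn 0)
  | m.+1 => lebesgue_step (lebesgue_Rn m)
  end.

Lemma lebesgue_Rn_box n (B : 'I_n -> set (measurableTypeR R)) :
  (forall i, measurable (B i)) ->
  (lebesgue_Rn n [set v : Rn n | forall i, B i (tnth v i)] =
   \prod_(i < n) lebesgue_measure (B i))%E.
Proof.
elim: n B => [|n IH] B mB.
  rewrite big_ord0 /= diracE mem_set//= => -[].
  by [].
rewrite big_ord_recl -IH//.
rewrite -product_measure1E//; last first.
  rewrite [X in measurable X](_ : _ =
    \bigcap_(i in [set: 'I_n]) ((@tnth _ _)^~ i @^-1` B (lift ord0 i))); last first.
    by apply/seteqP; split=> v /= Hv i; [move=> _|]; exact: Hv.
  apply: fin_bigcap_measurable => // i _; rewrite -[X in measurable X]setTI.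
  exact: (@measurable_tnth _ (measurableTypeR R) n i).
rewrite /= /lebesgue_step /pushforward; congr ((_ \x _)%E _).
apply/seteqP; split => -[x v] /=.
  move=> H; split; first exact: (H ord0).
  by move=> i; move: (H (lift ord0 i)); rewrite /= tnthS.
move=> [Hx Hv] i; case: (unliftP ord0 i) => [j|] -> //=.
by rewrite tnthS.
Qed.

End lebesgue_measure_Rn.

(* Main.v *)
From HB Require Import structures.
Require Import Defs.
From mathcomp Require Import all_boot all_order all_algebra.
From mathcomp Require Import complex.
From mathcomp Require Import all_classical all_reals all_analysis.
From mathcomp Require Import measurable_realfun ring lra.
Import Order.TTheory GRing.Theory Num.Theory.
Import numFieldNormedType.Exports.
Import ComplexField.Normc.

Set Implicit Arguments.
Unset Strict Implicit.
Unset Printing Implicit Defensive.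

Local Open Scope classical_set_scope.
Local Open Scope ring_scope.

(** Write [b_n] for the L2 norm of [A phi_n]. Since the pairing of the kernel
with [Phi m n] is [<A phi_n, phi_m>], the lower frame bound, applied to
[A phi_n] for each [n], turns the hypothesis into convergence of the sum of
the [b_n ^ p] ([pairing_tensor], [schatten_of_frame]).

If [f_j = sum_n c_jn phi_n], then [<A f_j, g_j>] is the sum over [n] of
[c_jn <A phi_n, g_j>]. For orthonormal [f] and [g], Bessel's inequality bounds
the sum over [j] of [|<A phi_n, g_j>|^2] by [b_n ^ 2], and for coefficients
coming from a dual frame the rows and the columns of [c] are uniformly bounded
in l2. These facts alone bound the sum over [j] of [|<A f_j, g_j>|^p] by a
multiple of the sum of the [b_n ^ p]: this is an elementary inequality on
nonnegative matrices, which interpolates between the cases [p = 1] (sum over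
[j] first) and [p = 2] (Cauchy-Schwarz over [n]) ([sum_powR_sum_mul_le]).

Instead of inverting the frame operator, which would call for the completeness
of L2, finitely many [f_j] are approximated simultaneously by finite
combinations of the [phi_n]. A residual [r] is replaced by [r - S_N r / B2],
where [S_N] is the frame operator truncated to finitely many terms; this
contracts the norm by a fixed factor provided that [N] is large enough for all
the combinations of the [r_j] at once. Working with all combinations in the
unit ball is what controls the columns of [c] ([frame_approx]).

The residuals are harmless once [A] is known to be bounded, which is part of
the conclusion and not of the hypotheses. Approximate one [f] with residuals
[r_i] that tend to [0] geometrically. The approximants have images of bounded
norm, because the sum of the [b_n ^ 2] converges as well. The [r_i] are
dominated by [2 ^ -i g] for a single [g] in L2; as the integral defining [A g]
converges absolutely almost everywhere, [A r_i] tends to [0] almost everywhere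
([ae_operator_cvg0]), and Fatou's lemma carries the bound over to [A f]
([sqnorm_operator_le], [L2op_bounded_unit]). *)

(** * Absolute values of complex numbers *)

Lemma normc_sqr (R : rcfType) (z : R[i]) :
  normc z ^+ 2 = complex.Re z ^+ 2 + complex.Im z ^+ 2.
Proof. by case: z => a b /=; rewrite sqr_sqrtr ?addr_ge0 ?sqr_ge0. Qed.

Lemma normc_real_sqr (R : rcfType) (x : R) : normc x%:C%C ^+ 2 = x ^+ 2.
Proof. by rewrite normc_sqr/= expr0n/= addr0. Qed.

Lemma normc_ge0 (R : rcfType) (z : R[i]) : 0 <= normc z.
Proof. by case: z => a b; exact: sqrtr_ge0. Qed.

Lemma normc_conj (R : rcfType) (z : R[i]) : normc (conjc z) = normc z.
Proof. by case: z => a b /=; rewrite sqrrN. Qed.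

Lemma norm_Re_le_normc (R : rcfType) (z : R[i]) : `|complex.Re z| <= normc z.
Proof.
rewrite -ler_sqr ?nnegrE ?normc_ge0// normc_sqr.
by rewrite real_normK ?num_real// lerDl sqr_ge0.
Qed.

Lemma norm_Im_le_normc (R : rcfType) (z : R[i]) : `|complex.Im z| <= normc z.
Proof.
rewrite -ler_sqr ?nnegrE ?normc_ge0// normc_sqr.
by rewrite real_normK ?num_real// lerDr sqr_ge0.
Qed.

Lemma normc_le_Re_Im (R : rcfType) (z : R[i]) :
  normc z <= `|complex.Re z| + `|complex.Im z|.
Proof.
rewrite -ler_sqr ?nnegrE ?normc_ge0 ?addr_ge0// normc_sqr sqrrD.
by rewrite !real_normK ?num_real// addrAC lerDl mulrn_wge0// mulr_ge0.
Qed.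

Lemma ler_Re_normc (R : rcfType) (z : R[i]) : complex.Re z <= normc z.
Proof. exact: le_trans (ler_norm _) (norm_Re_le_normc _). Qed.

Lemma conjcM (R : rcfType) (z w : R[i]) : conjc (z * w) = conjc z * conjc w.
Proof. exact: rmorphM. Qed.

Lemma mul_conjc (R : rcfType) (z : R[i]) : z * conjc z = (normc z ^+ 2)%:C%C.
Proof.
by rewrite normc_sqr; case: z => a b /=; apply/eqP; rewrite eq_complex /=;
  apply/andP; split; apply/eqP; ring.
Qed.

Lemma le_normc_sum (R : rcfType) (I : Type) (s : seq I) (P : pred I)
    (F : I -> R[i]) :
  normc (\sum_(i <- s | P i) F i) <= \sum_(i <- s | P i) normc (F i).
Proof.
elim/big_ind2 : _ => //; first by rewrite normc0.
by move=> x1 x2 y1 y2 h1 h2; rewrite (le_trans (le_normcD _ _))// lerD.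
Qed.

(** * Finite sums *)

Lemma cauchy_schwarz_sum (R : realFieldType) (I : Type) (s : seq I)
    (P : pred I) (x y : I -> R) :
  (\sum_(i <- s | P i) x i * y i) ^+ 2 <=
  (\sum_(i <- s | P i) x i ^+ 2) * (\sum_(i <- s | P i) y i ^+ 2).
Proof.
elim: s => [|a s IH]; first by rewrite !big_nil expr0n mul0r.
rewrite !big_cons; case: ifP => // _.
set C := \sum_(i <- s | P i) x i * y i in IH *.
set X := \sum_(i <- s | P i) x i ^+ 2 in IH *.
set Y := \sum_(i <- s | P i) y i ^+ 2 in IH *.
have X0 : 0 <= X by apply: sumr_ge0 => i _; exact: sqr_ge0.
have Y0 : 0 <= Y by apply: sumr_ge0 => i _; exact: sqr_ge0.
have key : 2 * C * (x a * y a) <= x a ^+ 2 * Y + X * y a ^+ 2.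
  have h : `|C * (x a * y a)| ^+ 2 <= (x a ^+ 2 * Y) * (X * y a ^+ 2).
    rewrite real_normK ?num_real//.
    apply: (@le_trans _ _ ((X * Y) * (x a * y a) ^+ 2)).
      by rewrite exprMn ler_wpM2r ?sqr_ge0.
    by rewrite le_eqVlt; apply/orP; left; apply/eqP; ring.
  set u := x a ^+ 2 * Y in h *; set v := X * y a ^+ 2 in h *.
  have u0 : 0 <= u by rewrite mulr_ge0 ?sqr_ge0.
  have v0 : 0 <= v by rewrite mulr_ge0 ?sqr_ge0.
  rewrite -mulrA; apply: (@le_trans _ _ (2 * `|C * (x a * y a)|)).
    by rewrite ler_pM2l// ler_norm.
  set t := `|_| in h *; have t0 : 0 <= t by exact: normr_ge0.
  rewrite -ler_sqr; [|exact: mulr_ge0|exact: addr_ge0].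
  have : 0 <= (u - v) ^+ 2 by exact: sqr_ge0.
  nra.
rewrite -subr_ge0.
have -> : (x a ^+ 2 + X) * (y a ^+ 2 + Y) - (x a * y a + C) ^+ 2 =
  (x a ^+ 2 * Y + X * y a ^+ 2 - 2 * C * (x a * y a)) + (X * Y - C ^+ 2).
  by ring.
by rewrite addr_ge0// subr_ge0.
Qed.

Lemma sum_normc_sqrD (R : rcfType) (I : Type) (s : seq I) (P : pred I)
    (x y : I -> R[i]) (X Y : R) : 0 <= X -> 0 <= Y ->
  \sum_(i <- s | P i) normc (x i) ^+ 2 <= X ^+ 2 ->
  \sum_(i <- s | P i) normc (y i) ^+ 2 <= Y ^+ 2 ->
  \sum_(i <- s | P i) normc (x i + y i) ^+ 2 <= (X + Y) ^+ 2.
Proof.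
move=> X0 Y0 hX hY.
apply: (@le_trans _ _ (\sum_(i <- s | P i) (normc (x i) + normc (y i)) ^+ 2)).
  apply: ler_sum => i _.
  by rewrite ler_sqr ?nnegrE ?addr_ge0 ?normc_ge0 ?le_normcD.
under eq_bigr do rewrite sqrrD.
rewrite !big_split/= sqrrD -mulr2n lerD// lerD// lerMn2r/=.
rewrite -ler_sqr ?nnegrE ?mulr_ge0//; last first.
  by apply: sumr_ge0 => i _; rewrite mulr_ge0 ?normc_ge0.
apply: (le_trans (cauchy_schwarz_sum _ _ _ _)).
by rewrite exprMn ler_pM//; apply: sumr_ge0 => i _; exact: sqr_ge0.
Qed.

Lemma normc_sum_mul_sqr (R : rcfType) (I : Type) (s : seq I) (P : pred I)
    (x y : I -> R[i]) :
  normc (\sum_(i <- s | P i) x i * y i) ^+ 2 <=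
  (\sum_(i <- s | P i) normc (x i) ^+ 2) *
  (\sum_(i <- s | P i) normc (y i) ^+ 2).
Proof.
apply: le_trans (cauchy_schwarz_sum _ _ _ _).
rewrite ler_sqr ?nnegrE ?normc_ge0//; last first.
  by apply: sumr_ge0 => i _; rewrite mulr_ge0 ?normc_ge0.
by apply: (le_trans (le_normc_sum _ _ _)); under eq_bigr do rewrite normcM.
Qed.

(** * Semi-inner products *)

(** Definiteness is not asked for, because functions that agree almost
everywhere are not identified. *)
Record semi_inner (R : rcfType) (V : lmodType R[i]) (ip : V -> V -> R[i])
  : Prop := SemiInner {
  semi_inner_linear : forall a u v w, ip (a *: u + v) w = a * ip u w + ip v w;
  semi_inner_sym : forall u v, ip v u = conjc (ip u v);
  semi_inner_ge0 : forall u, 0 <= ip u u }.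

Section semi_inner_theory.
Context (R : rcfType) (V : lmodType R[i]) (ip : V -> V -> R[i]).
Hypothesis ipP : semi_inner ip.

Definition nsq (v : V) : R := complex.Re (ip v v).

Lemma nsq_ge0 v : 0 <= nsq v.
Proof. by move: (semi_inner_ge0 ipP v); rewrite lecE => /andP[]. Qed.

Lemma nsqE v : ip v v = (nsq v)%:C%C.
Proof.
move: (semi_inner_ge0 ipP v); rewrite lecE => /andP[/= /eqP + _].
by rewrite /nsq; case: (ip v v) => a b /= ->.
Qed.

Lemma ipDl u v w : ip (u + v) w = ip u w + ip v w.
Proof. by rewrite -{1}[u]scale1r (semi_inner_linear ipP) mul1r. Qed.

Lemma ip0l w : ip 0 w = 0.
Proof. by apply: (addIr (ip 0 w)); rewrite -ipDl !add0r. Qed.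

Lemma ipZl a u w : ip (a *: u) w = a * ip u w.
Proof. by rewrite -[a *: u]addr0 (semi_inner_linear ipP) ip0l addr0. Qed.

Lemma ip_suml (I : Type) (s : seq I) (P : pred I) (F : I -> V) w :
  ip (\sum_(i <- s | P i) F i) w = \sum_(i <- s | P i) ip (F i) w.
Proof.
elim/big_ind2 : _ => //; first by rewrite ip0l.
by move=> _ x2 _ y2 <- <-; rewrite ipDl.
Qed.

Lemma ip_combl (I : Type) (s : seq I) (P : pred I) (a : I -> R[i])
    (F : I -> V) w :
  ip (\sum_(i <- s | P i) a i *: F i) w = \sum_(i <- s | P i) a i * ip (F i) w.
Proof. by rewrite ip_suml; under eq_bigr do rewrite ipZl. Qed.

Lemma ip_combr (I : Type) (s : seq I) (P : pred I) (a : I -> R[i])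
    (F : I -> V) w :
  ip w (\sum_(i <- s | P i) a i *: F i) =
  \sum_(i <- s | P i) conjc (a i) * ip w (F i).
Proof.
rewrite (semi_inner_sym ipP) ip_combl rmorph_sum; apply: eq_bigr => i _.
by rewrite [LHS]conjcM -(semi_inner_sym ipP).
Qed.

Lemma nsqZ a v : nsq (a *: v) = normc a ^+ 2 * nsq v.
Proof.
rewrite /nsq ipZl (semi_inner_sym ipP) ipZl nsqE conjcM mulrA mul_conjc.
by rewrite conjc_real /=; ring.
Qed.

Lemma nsqBZ u v a : nsq (u - a *: v) =
  nsq u - 2 * complex.Re (conjc a * ip u v) + normc a ^+ 2 * nsq v.
Proof.
have -> : u - a *: v = (- a) *: v + u by rewrite addrC scaleNr.
rewrite {1}/nsq (semi_inner_linear ipP) (semi_inner_sym ipP _ v).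
rewrite (semi_inner_sym ipP _ u) !(semi_inner_linear ipP).
rewrite (semi_inner_sym ipP u v) !nsqE normc_sqr.
by case: a => a1 a2; case: (ip u v) => x y /=; ring.
Qed.

Lemma cauchy_schwarz u v : normc (ip u v) ^+ 2 <= nsq u * nsq v.
Proof.
set z := ip u v; set Z := normc z ^+ 2.
have Z0 : 0 <= Z by exact: sqr_ge0.
have key (t : R) : 0 <= nsq u - 2 * t * Z + t ^+ 2 * Z * nsq v.
  have := nsq_ge0 (u - (t%:C%C * z) *: v).
  rewrite nsqBZ -/z !normcM exprMn -/Z conjcM conjc_real normc_real_sqr.
  rewrite -mulrA [conjc z * z]mulrC mul_conjc -/Z /= => h.
  by apply: (le_trans h); rewrite le_eqVlt; apply/orP; left; apply/eqP; ring.
have u0 := nsq_ge0 u; have v0 := nsq_ge0 v.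
have [v1|v1] := eqVneq (nsq v) 0.
  rewrite v1 mulr0; rewrite leNgt; apply/negP => Zp.
  have := key ((nsq u + 1) / Z); rewrite v1 mulr0 addr0.
  rewrite -!mulrA mulVf ?gt_eqF// mulr1; lra.
have vp : 0 < nsq v by rewrite lt_neqAle eq_sym v1.
have := key (nsq v)^-1.
have -> : nsq u - 2 * (nsq v)^-1 * Z + (nsq v)^-1 ^+ 2 * Z * nsq v =
          nsq u - Z / nsq v by field.
by rewrite subr_ge0 ler_pdivrMr.
Qed.

(** Duality: a Bessel bound for a family is also a bound for the synthesis of
combinations of that family. *)
Lemma nsq_comb_le (I : Type) (s : seq I) (P : pred I) (v : I -> V) (B : R)
    (c : I -> R[i]) : 0 <= B ->
  (forall w, \sum_(i <- s | P i) normc (ip w (v i)) ^+ 2 <= B * nsq w) ->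
  nsq (\sum_(i <- s | P i) c i *: v i) <=
  B * \sum_(i <- s | P i) normc (c i) ^+ 2.
Proof.
move=> B0 vB; set w := \sum_(i <- s | P i) _.
set C := \sum_(i <- s | P i) _.
have C0 : 0 <= C by apply: sumr_ge0 => n _; exact: sqr_ge0.
have w0 := nsq_ge0 w.
have h : nsq w ^+ 2 <= C * (B * nsq w).
  apply: (@le_trans _ _ (normc (ip w w) ^+ 2)).
    by rewrite ler_sqr ?nnegrE ?normc_ge0 ?ler_Re_normc.
  rewrite {1}/w ip_combl.
  apply: (le_trans (normc_sum_mul_sqr _ _ _ _)).
  rewrite ler_wpM2l//; apply: le_trans (vB w).
  by apply: ler_sum => n _; rewrite (semi_inner_sym ipP) normc_conj.
have [->|wn0] := eqVneq (nsq w) 0; first by rewrite mulr_ge0.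
have wp : 0 < nsq w by rewrite lt_neqAle eq_sym wn0.
by rewrite -(ler_pM2r wp) -expr2 (le_trans h)// mulrA [C * _]mulrC.
Qed.

Definition orthonormal (I : eqType) (f : I -> V) :=
  forall i j, ip (f i) (f j) = (i == j)%:R.

Lemma nsq_orthonormal_comb (I : finType) (f : I -> V) (a : I -> R[i]) :
  orthonormal f -> nsq (\sum_i a i *: f i) = \sum_i normc (a i) ^+ 2.
Proof.
move=> of_; rewrite /nsq ip_combl.
transitivity (complex.Re (\sum_i (normc (a i) ^+ 2)%:C%C)); last first.
  by rewrite -rmorph_sum.
congr complex.Re; apply: eq_bigr => i _.
rewrite ip_combr (bigD1 i)//= big1 => [|j ji].
  by rewrite of_ eqxx mulr1 addr0 mul_conjc.
by rewrite of_ eq_sym (negbTE ji) mulr0.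
Qed.

Lemma bessel (I : finType) (f : I -> V) (v : V) :
  orthonormal f -> \sum_i normc (ip v (f i)) ^+ 2 <= nsq v.
Proof.
move=> of_; have := nsq_ge0 (v - 1 *: \sum_i ip v (f i) *: f i).
rewrite nsqBZ nsq_orthonormal_comb// conjc1 normc1 expr1n !mul1r ip_combr.
rewrite (eq_bigr (fun i => (normc (ip v (f i)) ^+ 2)%:C%C)); last first.
  by move=> i _; rewrite mulrC mul_conjc.
rewrite -rmorph_sum/=; lra.
Qed.

End semi_inner_theory.

(** * Approximation by finite frame expansions *)

(** A frame indexed by the natural numbers, with partial sums in place of the
series. The normalisations [B1 <= B2] and [1 <= B2] can always be reached by
enlarging [B2]; they make the contraction factor positive and keep the
coefficients of a step below the norm of the residual. *)
Record frame_bounds (R : rcfType) (V : lmodType R[i]) (ip : V -> V -> R[i])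
  (psi : nat -> V) (B1 B2 : R) : Prop := FrameBounds {
  frame_bounds_gt0 : 0 < B1;
  frame_bounds_le : B1 <= B2;
  frame_bounds_ge1 : 1 <= B2;
  frame_upper : forall v N,
    \sum_(0 <= n < N) normc (ip v (psi n)) ^+ 2 <= B2 * nsq ip v;
  frame_lower : forall v e, 0 < e -> exists N,
    B1 * nsq ip v <= \sum_(0 <= n < N) normc (ip v (psi n)) ^+ 2 + e }.

Section frame_approximation.
Context (R : realType) (V : lmodType R[i]) (ip : V -> V -> R[i]).
Hypothesis ipP : semi_inner ip.
Context (psi : nat -> V) (B1 B2 : R).
Hypothesis psiP : frame_bounds ip psi B1 B2.

Let energy N v := \sum_(0 <= n < N) normc (ip v (psi n)) ^+ 2.

Let energy_le M N v : (M <= N)%N -> energy M v <= energy N v.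
Proof.
move=> MN; rewrite /energy (big_cat_nat (leq0n _) MN)//= lerDl.
by apply: sumr_ge0 => n _; exact: sqr_ge0.
Qed.

(** A gradient step of length [1 / B2] for the quadratic form of the truncated
frame operator [S_N]: the upper frame bound makes the second-order term at
most half of the first-order gain, so that the whole energy captured by [S_N]
is subtracted, up to the factor [1 / B2]. *)
Lemma nsq_step_le N v :
  nsq ip (v - B2^-1%:C%C *: \sum_(0 <= n < N) ip v (psi n) *: psi n) <=
  nsq ip v - B2^-1 * energy N v.
Proof.
set w := \sum_(_ <= n < _) _.
have B20 : 0 < B2 by rewrite (lt_le_trans ltr01)// (frame_bounds_ge1 psiP).
have vw : ip v w = (energy N v)%:C%C.
  rewrite (ip_combr ipP) /energy rmorph_sum; apply: eq_bigr => n _.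
  by rewrite mulrC mul_conjc.
rewrite (nsqBZ ipP) vw normc_real_sqr conjc_real -[_%:C%C * _]rmorphM/=.
have := nsq_comb_le ipP (fun n => ip v (psi n)) (ltW B20)
  (fun u => frame_upper psiP u N).
rewrite -/w -/(energy N v) => h.
have : B2^-1 ^+ 2 * nsq ip w <= B2^-1 * energy N v.
  apply: (@le_trans _ _ (B2^-1 ^+ 2 * (B2 * energy N v))).
    by rewrite ler_wpM2l ?sqr_ge0.
  by rewrite expr2 -mulrA mulKf ?gt_eqF.
lra.
Qed.

Let energy_tail v e : 0 < e ->
  exists N, forall M, (N <= M)%N -> energy M v <= energy N v + e.
Proof.
move=> e0; set S := [set energy N v | N in [set: nat]].
have ubS : has_ubound S.
  by exists (B2 * nsq ip v) => _ [N _ <-]; exact: (frame_upper psiP).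
have supS : has_sup S by split => //; exists (energy 0 v); exists 0%N.
have [_ [N _ <-] h] := sup_adherent e0 supS.
exists N => M _; rewrite -lerBlDr; apply: (le_trans _ (ltW h)).
by rewrite lerD2r; apply: ub_le_sup => //; exists M.
Qed.

Variable J : nat.

Definition unit_ball : set ('I_J -> R[i]) :=
  [set a | \sum_j normc (a j) ^+ 2 <= 1].

(** The lower frame bound survives truncation at an [N] common to all the
combinations in the unit ball: by Cauchy-Schwarz the tail of a combination is
at most the sum of the tails of the finitely many [r j]. *)
Lemma uniform_frame_lower (r : 'I_J -> V) e : 0 < e ->
  exists N, forall a, unit_ball a ->
    B1 * nsq ip (\sum_j a j *: r j) <= energy N (\sum_j a j *: r j) + e.
Proof.
move=> e0; set e' := e / 2 / J.+1%:R.
have e'0 : 0 < e' by rewrite !divr_gt0.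
have /choice[F hF] := fun j => energy_tail (r j) e'0.
pose N := (\max_j F j)%N.
have hN j M : (N <= M)%N -> energy M (r j) <= energy N (r j) + e'.
  move=> NM; have FN : (F j <= N)%N by exact: leq_bigmax.
  apply: (le_trans (hF j M (leq_trans FN NM))).
  by rewrite lerD2r energy_le.
exists N => a a1; set v := \sum_j _.
have [M0 hM0] := frame_lower psiP v (divr_gt0 e0 (ltr0Sn _ 1)).
pose M := maxn M0 N.
have NM : (N <= M)%N by exact: leq_maxr.
apply: (le_trans hM0); rewrite -/(energy M0 v).
apply: (@le_trans _ _ (energy M v + e / 2)).
  by rewrite lerD2r energy_le// leq_maxl.
suff tail : energy M v <= energy N v + e / 2 by lra.
rewrite /energy (big_cat_nat (leq0n _) NM)//= lerD2l.
apply: (@le_trans _ _ (\sum_(N <= n < M) \sum_j normc (ip (r j) (psi n)) ^+ 2)).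
  apply: ler_sum => n _; rewrite (ip_combl ipP).
  apply: (le_trans (normc_sum_mul_sqr _ _ _ _)).
  by rewrite ler_piMl//; apply: sumr_ge0 => j _; exact: sqr_ge0.
rewrite exchange_big/=.
apply: (@le_trans _ _ (\sum_(j < J) e')).
  apply: ler_sum => j _; move: (hN j M NM).
  by rewrite /energy (big_cat_nat (leq0n _) NM)//= lerD2l.
rewrite sumr_const card_ord -[_ *+ J]mulr_natr.
have -> : e / 2 = e' * J.+1%:R by rewrite divfK// pnatr_eq0.
by rewrite ler_pM2l// ler_nat.
Qed.

(* A step multiplies the squared norm by at most [1 - B1 / (2 B2)], which is
at most [q ^ 2]. *)
Let q : R := 1 - B1 / (4 * B2).

Let B20 : 0 < B2.
Proof. by rewrite (lt_le_trans ltr01)// (frame_bounds_ge1 psiP). Qed.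

Let q_gt0 : 0 < q.
Proof.
rewrite subr_gt0 ltr_pdivrMr ?mulr_gt0// mul1r.
by have := frame_bounds_le psiP; have := B20; lra.
Qed.

Let q_lt1 : q < 1.
Proof. by rewrite ltrBlDr ltrDl divr_gt0 ?mulr_gt0// (frame_bounds_gt0 psiP). Qed.

(** Iteration of the step. The coefficients added at step [k] have l2 norm at
most [q ^ k], hence the geometric sum bounding their accumulation. *)
Lemma frame_approx_geometric (f : 'I_J -> V) :
  (forall a, unit_ball a -> nsq ip (\sum_j a j *: f j) <= 1) ->
  forall k, exists N (c : 'I_J -> nat -> R[i]),
  [/\ forall a, unit_ball a -> nsq ip (\sum_j a j *:
        (f j - \sum_(0 <= n < N) c j n *: psi n)) <= q ^+ k ^+ 2,
      forall a M, unit_ball a ->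
        \sum_(0 <= n < M) normc (\sum_j a j * c j n) ^+ 2 <=
        ((1 - q ^+ k) / (1 - q)) ^+ 2 &
      forall j n, (N <= n)%N -> c j n = 0].
Proof.
move=> f1; elim=> [|k [N [c [res_le coef_le supp]]]].
  exists 0%N, (fun _ _ => 0); split => //.
  - move=> a a1; rewrite expr0 expr1n; apply: le_trans (f1 a a1).
    by under eq_bigr do rewrite big_geq// subr0.
  - move=> a M _; rewrite expr0 subrr mul0r expr0n/= big1// => n _.
    by rewrite big1 ?normc0 ?expr0n// => j _; rewrite mulr0.
have qk : 0 < q ^+ k by rewrite exprn_gt0.
pose r j := f j - \sum_(0 <= n < N) c j n *: psi n.
(* The tail may use up half of the gain guaranteed by the lower bound. *)
have e0 : 0 < B1 / 2 * q ^+ k ^+ 2.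
  by rewrite mulr_gt0 ?exprn_gt0// divr_gt0// (frame_bounds_gt0 psiP).
have [N1 hN1] := uniform_frame_lower r e0.
pose d j n : R[i] := if (n < N1)%N then B2^-1%:C%C * ip (r j) (psi n) else 0.
exists (maxn N N1), (fun j n => c j n + d j n).
have comb_d a n : \sum_j a j * d j n =
    if (n < N1)%N then B2^-1%:C%C * ip (\sum_j a j *: r j) (psi n) else 0.
  rewrite /d; case: ifP => _; last by rewrite big1// => j _; rewrite mulr0.
  by rewrite (ip_combl ipP) mulr_sumr; apply: eq_bigr => j _; ring.
split.
- move=> a a1.
  have -> : \sum_j a j *: (f j -
      \sum_(0 <= n < maxn N N1) (c j n + d j n) *: psi n) =
    \sum_j a j *: r j - B2^-1%:C%C *:
      \sum_(0 <= n < N1) ip (\sum_j a j *: r j) (psi n) *: psi n.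
    have cN j : \sum_(0 <= n < maxn N N1) c j n *: psi n =
        \sum_(0 <= n < N) c j n *: psi n.
      rewrite (big_cat_nat (leq0n _) (leq_maxl N N1))//= [X in _ + X]big_nat_cond.
      rewrite [X in _ + X]big1 ?addr0// => n /andP[/andP[Nn _] _].
      by rewrite supp// scale0r.
    have dN j : \sum_(0 <= n < maxn N N1) d j n *: psi n =
        B2^-1%:C%C *: \sum_(0 <= n < N1) ip (r j) (psi n) *: psi n.
      rewrite (big_cat_nat (leq0n _) (leq_maxr N N1))//= [X in _ + X]big_nat_cond.
      rewrite [X in _ + X]big1 ?addr0 => [|n /andP[/andP[Nn _] _]]; last first.
        by rewrite /d ltnNge Nn/= scale0r.
      rewrite scaler_sumr [LHS]big_nat_cond [RHS]big_nat_cond.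
      apply: eq_bigr => n /andP[/andP[_ nN] _].
      by rewrite /d nN scalerA.
    transitivity (\sum_j (a j *: r j - a j *: (B2^-1%:C%C *:
        \sum_(0 <= n < N1) ip (r j) (psi n) *: psi n))).
      apply: eq_bigr => j _; rewrite -scalerBr; congr (_ *: _).
      under eq_bigr do rewrite scalerDl.
      by rewrite big_split/= cN dN opprD addrA.
    rewrite sumrB; congr (_ - _).
    under eq_bigr do rewrite scalerA mulrC -scalerA.
    rewrite -scaler_sumr; congr (_ *: _).
    under eq_bigr do rewrite scaler_sumr.
    rewrite exchange_big/=; apply: eq_bigr => n _.
    rewrite (ip_combl ipP) scaler_suml; apply: eq_bigr => j _.
    by rewrite scalerA.
  apply: (le_trans (nsq_step_le _ _)).
  have := hN1 a a1; have := res_le a a1; rewrite -/r.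
  set v := \sum_j _; set Q := q ^+ k ^+ 2 => vQ low.
  have B1le := frame_bounds_le psiP; have B1gt := frame_bounds_gt0 psiP.
  set t := B1 / B2; have tE : t = B1 / B2 by [].
  have t1 : t <= 1 by rewrite ler_pdivrMr// mul1r.
  have t0 : 0 < t by rewrite divr_gt0.
  have low' : t * nsq ip v <= B2^-1 * energy N1 v + t / 2 * Q.
    move: low; rewrite -(ler_pM2l (_ : 0 < B2^-1)) ?invr_gt0//.
    by rewrite mulrA [B2^-1 * B1]mulrC mulrDr -/t !mulrA [B2^-1 * B1]mulrC.
  have qE : q = 1 - t / 4 by rewrite /q /t invfM; congr (_ - _); ring.
  have -> : q ^+ k.+1 ^+ 2 = q ^+ 2 * Q by rewrite (exprS q k) exprMn.
  have Q0 : 0 <= Q by exact: sqr_ge0.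
  have h1 : (1 - t) * nsq ip v <= (1 - t) * Q by rewrite ler_wpM2l// subr_ge0.
  have h2 : (1 - t / 2) * Q <= q ^+ 2 * Q.
    by rewrite ler_wpM2r// qE; have := sqr_ge0 (t / 4); nra.
  lra.
- move=> a M a1.
  have -> : (1 - q ^+ k.+1) / (1 - q) = (1 - q ^+ k) / (1 - q) + q ^+ k.
    by rewrite exprS; field; rewrite subr_eq0 gt_eqF.
  under eq_bigr do under eq_bigr do rewrite mulrDr.
  under eq_bigr do rewrite big_split/=.
  apply: sum_normc_sqrD => //.
  - by rewrite divr_ge0// subr_ge0 ?exprn_ile1// ltW.
  - by rewrite ltW.
  - exact: coef_le.
  under eq_bigr do rewrite comb_d.
  set v := \sum_j _.
  apply: (@le_trans _ _
    (\sum_(0 <= n < M) normc (B2^-1%:C%C * ip v (psi n)) ^+ 2)).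
    apply: ler_sum => n _; case: ifP => // _.
    by rewrite normc0 expr0n/= sqr_ge0.
  under eq_bigr do rewrite normcM exprMn normc_real_sqr.
  rewrite -mulr_sumr.
  apply: (@le_trans _ _ (B2^-1 ^+ 2 * (B2 * nsq ip v))).
    by rewrite ler_wpM2l ?sqr_ge0// (frame_upper psiP).
  rewrite expr2 -mulrA mulKf ?gt_eqF//.
  apply: le_trans (res_le a a1); rewrite ler_piMl ?(nsq_ge0 ipP)//.
  by rewrite invf_le1// (frame_bounds_ge1 psiP).
- move=> j n; rewrite geq_max => /andP[Nn N1n].
  by rewrite supp// add0r /d ltnNge N1n.
Qed.

Let qD : (1 - q)^-1 = 4 * B2 / B1.
Proof.
by rewrite /q opprB addrC subrK invf_div.
Qed.

(** A bound of the coefficient matrix as an operator on the unit ball of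
combinations bounds its rows (test on the coordinate vectors) and its columns
(test on the conjugate of the column). The bounds depend neither on the
accuracy [e] nor on the number [J] of vectors. *)
Lemma frame_approx (f : 'I_J -> V) (e : R) :
  0 < e -> (forall a, unit_ball a -> nsq ip (\sum_j a j *: f j) <= 1) ->
  exists N (c : 'I_J -> nat -> R[i]),
  [/\ forall j, nsq ip (f j - \sum_(0 <= n < N) c j n *: psi n) <= e,
      forall j, \sum_(0 <= n < N) normc (c j n) ^+ 2 <= (4 * B2 / B1) ^+ 2 &
      forall n, \sum_j normc (c j n) ^+ 2 <= (4 * B2 / B1) ^+ 2].
Proof.
rewrite -qD => e0 f1.
have [k hk] : exists k, q ^+ k ^+ 2 <= e.
  have /cvgrPdist_lt/(_ _ e0) : (fun k => q ^+ k) @ \oo --> 0.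
    by apply: cvg_expr; rewrite ger0_norm// ltW.
  move=> [k _ /(_ k (leqnn k))]; rewrite sub0r normrN => h.
  exists k; apply: le_trans (ltW h).
  have qk0 : 0 <= q ^+ k by rewrite exprn_ge0// ltW.
  by rewrite ger0_norm// expr2 ler_piMl// exprn_ile1// ltW.
have [N [c [res_le coef_le _]]] := frame_approx_geometric f1 k.
have D0 : 0 < (1 - q)^-1 by rewrite invr_gt0 subr_gt0.
have coef_le' a M : unit_ball a ->
    \sum_(0 <= n < M) normc (\sum_j a j * c j n) ^+ 2 <= ((1 - q)^-1) ^+ 2.
  move=> a1; apply: (le_trans (coef_le a M a1)).
  have qk1 : q ^+ k <= 1 by rewrite exprn_ile1// ltW.
  have qk0 : 0 <= q ^+ k by rewrite exprn_ge0// ltW.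
  have D0' := ltW D0.
  by rewrite ler_sqr ?nnegrE ?mulr_ge0 ?subr_ge0// ler_piMl// gerBl.
pose delta j0 := fun j : 'I_J => (j == j0)%:R : R[i].
have delta1 j0 : unit_ball (delta j0).
  rewrite /unit_ball/= (bigD1 j0)//= big1 => [|j /negbTE jj0].
    by rewrite /delta eqxx normc1 expr1n addr0.
  by rewrite /delta jj0 normc0 expr0n.
have deltaZ (F : 'I_J -> V) j : \sum_i delta j i *: F i = F j.
  rewrite (bigD1 j)//= big1 => [|i /negbTE ij]; last by rewrite /delta ij scale0r.
  by rewrite /delta eqxx scale1r addr0.
have deltaM (F : 'I_J -> R[i]) j : \sum_i delta j i * F i = F j.
  rewrite (bigD1 j)//= big1 => [|i /negbTE ij]; last by rewrite /delta ij mul0r.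
  by rewrite /delta eqxx mul1r addr0.
exists N, c; split.
- move=> j; apply: (le_trans _ hk); apply: le_trans (res_le _ (delta1 j)).
  by rewrite deltaZ.
- move=> j; apply: le_trans (coef_le' _ N (delta1 j)).
  by under [leRHS]eq_bigr do rewrite deltaM.
- move=> n; set S := \sum_j _.
  have S0 : 0 <= S by apply: sumr_ge0 => j _; exact: sqr_ge0.
  have [->|Sn0] := eqVneq S 0; first by rewrite sqr_ge0.
  have Sp : 0 < S by rewrite lt_neqAle eq_sym Sn0.
  pose a j : R[i] := (Num.sqrt S)^-1%:C%C * conjc (c j n).
  have na j : normc (a j) ^+ 2 = S^-1 * normc (c j n) ^+ 2.
    rewrite /a normcM exprMn normc_conj normc_real_sqr.
    by rewrite exprVn sqr_sqrtr.
  have a1 : unit_ball a.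
    rewrite /unit_ball/=; under eq_bigr do rewrite na.
    by rewrite -mulr_sumr -/S mulVf.
  have := coef_le' a n.+1 a1; apply: le_trans.
  rewrite big_nat_recr//= (_ : \sum_j a j * c j n = (Num.sqrt S)%:C%C).
    rewrite normc_real_sqr sqr_sqrtr// lerDr.
    by apply: sumr_ge0 => m _; exact: sqr_ge0.
  transitivity ((Num.sqrt S)^-1 * S)%:C%C.
    rewrite /S mulr_sumr rmorph_sum; apply: eq_bigr => j _.
    by rewrite /a -mulrA [conjc _ * _]mulrC mul_conjc -[_ * _]rmorphM.
  by congr _%:C%C; rewrite -{2}(sqr_sqrtr S0) expr2 mulKf// sqrtr_eq0 -ltNge.
Qed.

End frame_approximation.

(** * The interpolation inequality *)

(** If [x u <= c], the first square suffices. Otherwise either [u >= 1] and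
[u <= u ^ p], or [u < 1] and [u ^ 2 <= u ^ p]; these two cases are where
[1 <= p] and [p <= 2] come from. *)
Lemma mul3_le_powR (R : realType) (p c x u : R) :
  1 <= p <= 2 -> 0 <= c -> 0 <= x -> 0 <= u ->
  c * x * u <= c ^+ 2 + u `^ p * (c ^+ 2 + x ^+ 2).
Proof.
move=> /andP[p1 p2] c0 x0 u0.
have c20 := sqr_ge0 c; have x20 := sqr_ge0 x; have up0 := powR_ge0 u p.
have [xuc|cxu] := leP (x * u) c.
  apply: (@le_trans _ _ (c ^+ 2)); last by rewrite lerDl mulr_ge0 ?addr_ge0.
  by rewrite expr2 -mulrA ler_wpM2l.
apply: (@le_trans _ _ (u `^ p * (c ^+ 2 + x ^+ 2))); last by rewrite lerDr.
have [u1|u1] := leP 1 u.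
  have uup : u <= u `^ p by rewrite -{1}[u]powRr1// ler_powR.
  rewrite mulrC ler_pM ?mulr_ge0//.
  by have := sqr_ge0 (c - x); rewrite sqrrB; have := mulr_ge0 c0 x0; lra.
have u2up : u ^+ 2 <= u `^ p.
  have [->|un0] := eqVneq u 0; first by rewrite expr0n/= powR_ge0.
  rewrite -powR_mulrn// ger_powR// (ltW u1) andbT lt_neqAle eq_sym un0//.
apply: (@le_trans _ _ (u ^+ 2 * x ^+ 2)).
  rewrite -mulrA -exprMn [u * x]mulrC expr2 ler_wpM2r ?mulr_ge0//.
  exact: ltW.
by rewrite ler_pM// ?sqr_ge0// lerDr.
Qed.

(** A substitute for Holder's inequality in which the weights [c n] and the
ratios [y n / b n] enter through their squares only, ready to be summed over
rows. Where [b n = 0] also [y n = 0], and the ratio is [0] by convention. *)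
Lemma powR_sum_mul_le (R : realType) (p : R) N (c y b : nat -> R) (D : R) :
  1 <= p <= 2 -> (forall n, 0 <= c n) -> (forall n, 0 <= y n) ->
  (forall n, 0 <= b n) -> (forall n, y n <= b n) -> 1 <= D ->
  \sum_(0 <= n < N) c n ^+ 2 <= D ->
  (\sum_(0 <= n < N) c n * y n) `^ p <=
  4 * D * \sum_(0 <= n < N) b n `^ p * (c n ^+ 2 + (y n / b n) ^+ 2).
Proof.
move=> p12 c0 y0 b0 yb D1 cD; have /andP[p1 p2] := p12.
set S := \sum_(0 <= n < N) c n * y n.
set W := \sum_(0 <= n < N) b n `^ p * _.
have D0 : 0 < D by lra.
have W0 : 0 <= W.
  by apply: sumr_ge0 => n _; rewrite mulr_ge0 ?powR_ge0// addr_ge0 ?sqr_ge0.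
have S0 : 0 <= S by apply: sumr_ge0 => n _; rewrite mulr_ge0.
have [->|Sn0] := eqVneq S 0.
  by rewrite powR0 ?gt_eqF ?(lt_le_trans ltr01)// !mulr_ge0// ltW.
have Sp : 0 < S by rewrite lt_neqAle eq_sym Sn0.
(* With this threshold the quadratic terms absorb at most half of the sum. *)
pose s := S / (2 * D).
have s0 : 0 < s by rewrite divr_gt0// mulr_gt0.
have t0 : 0 < s `^ p by rewrite powR_gt0.
have main : S <= s * (D + (s `^ p)^-1 * W).
  apply: (@le_trans _ _ (s * \sum_(0 <= n < N) (c n ^+ 2 +
      (s `^ p)^-1 * (b n `^ p * (c n ^+ 2 + (y n / b n) ^+ 2))))); last first.
    by rewrite ler_pM2l// big_split/= -mulr_sumr lerD2r.
  rewrite mulr_sumr; apply: ler_sum => n _.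
  have -> : c n * y n = s * (c n * (y n / b n) * (b n / s)).
    have [bn0|bn0] := eqVneq (b n) 0.
      have -> : y n = 0 by apply/eqP; rewrite eq_le y0 andbT -bn0 yb.
      by rewrite !(mul0r, mulr0).
    by field; rewrite bn0 gt_eqF.
  rewrite ler_pM2l//.
  apply: (le_trans (mul3_le_powR p12 _ _ _)) => //.
  - by rewrite divr_ge0.
  - by rewrite divr_ge0// ltW.
  rewrite lerD2l powRM ?invr_ge0 ?(ltW s0)//.
  have -> : s^-1 `^ p = (s `^ p)^-1.
    by rewrite -[s^-1]powR_inv1 ?(ltW s0)// -powRrM mulN1r powRN.
  by rewrite mulrA [_^-1 * _]mulrC.
have sD : s * D = S / 2 by rewrite /s; field; rewrite gt_eqF.
have half : S / 2 <= s * ((s `^ p)^-1 * W).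
  by move: main; rewrite mulrDr sD; lra.
have tW : s `^ p * D <= W.
  by move: half; rewrite -sD ler_pM2l// ler_pdivlMl.
have -> : S = s * (2 * D) by rewrite /s divfK// mulf_neq0 ?gt_eqF.
rewrite powRM ?(ltW s0)//; last by rewrite mulr_ge0// ltW.
have D2 : (2 * D) `^ p <= 4 * D ^+ 2.
  rewrite (_ : 4 * _ = (2 * D) `^ 2%:R); first by rewrite ler_powR//; lra.
  by rewrite powR_mulrn; [ring|rewrite mulr_ge0 ?ltW].
apply: (@le_trans _ _ (s `^ p * (4 * D ^+ 2))); first by rewrite ler_pM2l.
have -> : s `^ p * (4 * D ^+ 2) = 4 * D * (s `^ p * D) by ring.
by rewrite ler_pM2l// mulr_gt0.
Qed.

(** For [y j n = |<A phi_n, g_j>|] and [b n] the norm of [A phi_n], the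
bound on [y] is Bessel's inequality. *)
Lemma sum_powR_sum_mul_le (R : realType) (p : R) J N (c y : 'I_J -> nat -> R)
    (b : nat -> R) (D K : R) :
  1 <= p <= 2 -> (forall j n, 0 <= c j n) -> (forall j n, 0 <= y j n) ->
  (forall n, 0 <= b n) -> 1 <= D ->
  (forall j, \sum_(0 <= n < N) c j n ^+ 2 <= D) ->
  (forall n, \sum_j c j n ^+ 2 <= D) ->
  (forall n, \sum_j y j n ^+ 2 <= b n ^+ 2) ->
  \sum_(0 <= n < N) b n `^ p <= K ->
  \sum_j (\sum_(0 <= n < N) c j n * y j n) `^ p <= 4 * D * ((D + 1) * K).
Proof.
move=> p12 c0 y0 b0 D1 rowD colD yb bK.
have yb' j n : y j n <= b n.
  rewrite -ler_sqr ?nnegrE//; apply: le_trans (yb n).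
  by rewrite (bigD1 j)//= lerDl sumr_ge0// => i _; exact: sqr_ge0.
have D0 : 0 < D by lra.
apply: (@le_trans _ _ (\sum_j 4 * D * \sum_(0 <= n < N)
    b n `^ p * (c j n ^+ 2 + (y j n / b n) ^+ 2))).
  by apply: ler_sum => j _; exact: powR_sum_mul_le.
rewrite -mulr_sumr ler_pM2l ?mulr_gt0// exchange_big/=.
apply: (@le_trans _ _ (\sum_(0 <= n < N) b n `^ p * (D + 1))).
  apply: ler_sum => n _; rewrite -mulr_sumr ler_wpM2l ?powR_ge0//.
  rewrite big_split/= lerD//.
  under eq_bigr do rewrite expr_div_n.
  rewrite -mulr_suml; have [->|bn0] := eqVneq (b n) 0.
    by rewrite expr0n/= invr0 mulr0.
  by rewrite ler_pdivrMr ?mul1r// exprn_even_gt0.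
by rewrite -mulr_suml mulrC ler_wpM2l// ltW// ltr_wpDl// ltW.
Qed.

(** * The space L2 *)

Lemma normcD_sqr_le (R : rcfType) (z w : R[i]) :
  normc (z + w) ^+ 2 <= 2 * (normc z ^+ 2 + normc w ^+ 2).
Proof.
rewrite !normc_sqr; case: z w => a b [c d] /=.
by have := sqr_ge0 (a - c); have := sqr_ge0 (b - d); nra.
Qed.

Section complex_measurability.
Context d (T : measurableType d) (R : realType).
Implicit Types f g : T -> R[i].

Lemma cmeasurable_cst (a : R[i]) : cmeasurable (fun _ : T => a).
Proof. by split; exact: measurable_cst. Qed.

Lemma cmeasurableD f g : cmeasurable f -> cmeasurable g ->
  cmeasurable (fun x => f x + g x).
Proof.
move=> [f1 f2] [g1 g2]; split.
- apply: (eq_measurable_fun (fun x => complex.Re (f x) + complex.Re (g x))).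
    by move=> x _; case: (f x) (g x) => ? ? [].
  exact: measurable_funD.
- apply: (eq_measurable_fun (fun x => complex.Im (f x) + complex.Im (g x))).
    by move=> x _; case: (f x) (g x) => ? ? [].
  exact: measurable_funD.
Qed.

Lemma cmeasurableM f g : cmeasurable f -> cmeasurable g ->
  cmeasurable (fun x => f x * g x).
Proof.
move=> [f1 f2] [g1 g2]; split.
- apply: (eq_measurable_fun (fun x => complex.Re (f x) * complex.Re (g x) -
    complex.Im (f x) * complex.Im (g x))).
    by move=> x _; case: (f x) (g x) => ? ? [].
  by apply: measurable_funB; exact: measurable_funM.
- apply: (eq_measurable_fun (fun x => complex.Re (f x) * complex.Im (g x) +
    complex.Im (f x) * complex.Re (g x))).
    by move=> x _; case: (f x) (g x) => ? ? [].
  by apply: measurable_funD; exact: measurable_funM.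
Qed.

Lemma cmeasurable_conj f : cmeasurable f -> cmeasurable (fun x => conjc (f x)).
Proof.
move=> [f1 f2]; split.
- apply: (eq_measurable_fun (fun x => complex.Re (f x))) => //.
  by move=> x _; case: (f x).
- apply: (eq_measurable_fun (fun x => - complex.Im (f x))).
    by move=> x _; case: (f x).
  exact: measurableT_comp.
Qed.

Lemma measurable_normc_sqr f : cmeasurable f ->
  measurable_fun [set: T] (fun x => normc (f x) ^+ 2).
Proof.
move=> [f1 f2].
apply: (eq_measurable_fun
  (fun x => complex.Re (f x) ^+ 2 + complex.Im (f x) ^+ 2)).
  by move=> x _; rewrite normc_sqr.
by apply: measurable_funD; exact: measurable_funX.
Qed.

End complex_measurability.

Section complex_integral.
Context d (T : measurableType d) (R : realType).
Variable mu : {measure set T -> \bar R}.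
Implicit Types f g : T -> R[i].

Lemma cintegrable_dominated f (u : T -> R) : cmeasurable f ->
  mu.-integrable [set: T] (EFin \o u) -> (forall x, normc (f x) <= u x) ->
  cintegrable mu f.
Proof.
move=> [f1 f2] iu fu; split.
- apply: (le_integrable _ _ _ iu) => //; first exact/measurable_EFinP.
  move=> x _; rewrite /= lee_fin (le_trans _ (ler_norm _))//.
  exact: le_trans (norm_Re_le_normc _) (fu x).
- apply: (le_integrable _ _ _ iu) => //; first exact/measurable_EFinP.
  move=> x _; rewrite /= lee_fin (le_trans _ (ler_norm _))//.
  exact: le_trans (norm_Im_le_normc _) (fu x).
Qed.

Lemma cintegrable_cmeasurable f : cintegrable mu f -> cmeasurable f.
Proof.
by move=> [/measurable_int/measurable_EFinP f1 /measurable_int/measurable_EFinP].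
Qed.

Let integrable_comb (a b : R) (u v : T -> R) :
  mu.-integrable [set: T] (EFin \o u) -> mu.-integrable [set: T] (EFin \o v) ->
  mu.-integrable [set: T] (EFin \o (fun x => a * u x + b * v x)).
Proof.
move=> iu iv.
have := integrableD measurableT (integrableZl measurableT a iu)
  (integrableZl measurableT b iv).
by apply: eq_integrable => // x _; rewrite /= EFinD !EFinM.
Qed.

Let Rintegral_comb (a b : R) (u v : T -> R) :
  mu.-integrable [set: T] (EFin \o u) -> mu.-integrable [set: T] (EFin \o v) ->
  \int[mu]_x (a * u x + b * v x) = a * \int[mu]_x u x + b * \int[mu]_x v x.
Proof.
move=> iu iv; rewrite RintegralD ?RintegralZl//.
- have := integrableZl measurableT a iu.
  by apply: eq_integrable => // x _; rewrite /= EFinM.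
- have := integrableZl measurableT b iv.
  by apply: eq_integrable => // x _; rewrite /= EFinM.
Qed.

Lemma cintegrableZ (a : R[i]) f : cintegrable mu f ->
  cintegrable mu (fun x => a * f x).
Proof.
case: a => a b [f1 f2]; split.
- have := integrable_comb a (- b) f1 f2; apply: eq_integrable => // x _ /=.
  by congr EFin; case: (f x) => ? ? /=; ring.
- have := integrable_comb a b f2 f1; apply: eq_integrable => // x _ /=.
  by congr EFin; case: (f x) => ? ? /=; ring.
Qed.

Lemma cintegralZ (a : R[i]) f : cintegrable mu f ->
  cintegral mu (fun x => a * f x) = a * cintegral mu f.
Proof.
case: a => a b [f1 f2]; rewrite /cintegral; apply/eqP; rewrite eq_complex /=.
apply/andP; split; apply/eqP.
- rewrite -mulNr -Rintegral_comb//; apply: eq_Rintegral => x _.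
  by case: (f x) => ? ? /=; ring.
- rewrite -Rintegral_comb//; apply: eq_Rintegral => x _.
  by case: (f x) => ? ? /=; ring.
Qed.

Lemma cintegralD f g : cintegrable mu f -> cintegrable mu g ->
  cintegral mu (fun x => f x + g x) = cintegral mu f + cintegral mu g.
Proof.
move=> [f1 f2] [g1 g2]; rewrite /cintegral; apply/eqP; rewrite eq_complex /=.
apply/andP; split; apply/eqP.
- rewrite -[X in X + _]mul1r -[X in _ + X]mul1r -Rintegral_comb//.
  by apply: eq_Rintegral => x _; case: (f x) (g x) => ? ? [] ? ? /=; ring.
- rewrite -[X in X + _]mul1r -[X in _ + X]mul1r -Rintegral_comb//.
  by apply: eq_Rintegral => x _; case: (f x) (g x) => ? ? [] ? ? /=; ring.
Qed.

Lemma cintegral_conj f : cintegrable mu f ->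
  cintegral mu (fun x => conjc (f x)) = conjc (cintegral mu f).
Proof.
move=> [f1 f2]; rewrite /cintegral /=; congr Complex.
  by apply: eq_Rintegral => x _; case: (f x).
rewrite -mulN1r -RintegralZl//; apply: eq_Rintegral => x _.
by case: (f x) => ? ? /=; ring.
Qed.

Lemma ae_eq_cintegral f g : cmeasurable f -> cmeasurable g ->
  {ae mu, forall x, f x = g x} -> cintegral mu f = cintegral mu g.
Proof.
move=> [f1 f2] [g1 g2] fg; rewrite /cintegral /Rintegral.
congr (Complex (fine _) (fine _)).
- apply: ae_eq_integral => //; [exact/measurable_EFinP..|].
  by apply: filterS fg => x /= ->.
- apply: ae_eq_integral => //; [exact/measurable_EFinP..|].
  by apply: filterS fg => x /= ->.
Qed.

End complex_integral.

Section L2_space.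
Context d (T : measurableType d) (R : realType).
Variable mu : {measure set T -> \bar R}.
Implicit Types f g : T -> R[i].

Lemma L2_integrable f : L2 mu f ->
  mu.-integrable [set: T] (EFin \o (fun x => normc (f x) ^+ 2)).
Proof.
move=> [mf foo]; apply/integrableP; split.
  exact/measurable_EFinP/measurable_normc_sqr.
move: foo; rewrite /sqnorm; congr (_ < _)%E; apply: eq_integral => x _ /=.
by rewrite ger0_norm ?sqr_ge0.
Qed.

Lemma L2_dominated f (u : T -> R) : cmeasurable f ->
  mu.-integrable [set: T] (EFin \o u) ->
  (forall x, normc (f x) ^+ 2 <= u x) -> L2 mu f.
Proof.
move=> mf iu fu; split => //.
apply: (le_lt_trans _ (integrable_lty measurableT iu)).
apply: ge0_le_integral => //.
- by move=> x _; rewrite lee_fin sqr_ge0.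
- exact/measurable_EFinP/measurable_normc_sqr.
- exact: measurable_int iu.
- by move=> x _; rewrite lee_fin.
Qed.

Let integrable_sqr_comb (a b : R) f g : L2 mu f -> L2 mu g ->
  mu.-integrable [set: T]
    (EFin \o (fun x => a * normc (f x) ^+ 2 + b * normc (g x) ^+ 2)).
Proof.
move=> /L2_integrable if_ /L2_integrable ig.
have := integrableD measurableT (integrableZl measurableT a if_)
  (integrableZl measurableT b ig).
by apply: eq_integrable => // x _; rewrite /= EFinD !EFinM.
Qed.

Lemma L2_linear (a : R[i]) f g : L2 mu f -> L2 mu g ->
  L2 mu (fun x => a * f x + g x).
Proof.
move=> fL gL; apply: (L2_dominated _
  (integrable_sqr_comb (2 * normc a ^+ 2) 2 fL gL)).
  apply: cmeasurableD (gL.1); apply: cmeasurableM (fL.1).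
  exact: cmeasurable_cst.
move=> x; apply: (le_trans (normcD_sqr_le _ _)).
by rewrite normcM exprMn mulrDr mulrA.
Qed.

Lemma L2_0 : L2 mu (fun=> 0).
Proof.
split; first exact: cmeasurable_cst.
rewrite /sqnorm; under eq_integral do rewrite normc0 expr0n/=.
by rewrite integral0.
Qed.

Lemma L2_mul_conj f g : L2 mu f -> L2 mu g ->
  cintegrable mu (fun x => f x * conjc (g x)).
Proof.
move=> fL gL; apply: (cintegrable_dominated _ (integrable_sqr_comb 1 1 fL gL)).
  by apply: cmeasurableM (fL.1) _; apply: cmeasurable_conj (gL.1).
move=> x; rewrite normcM normc_conj !mul1r.
have := sqr_ge0 (normc (f x) - normc (g x)); rewrite sqrrB.
by have := mulr_ge0 (normc_ge0 (f x)) (normc_ge0 (g x)); lra.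
Qed.

(** L2 is kept as a subspace of the functions, without quotient, so that the
pointwise operator acts on it directly. *)
Definition L2pred : {pred (T -> R[i])} := [pred f | `[< L2 mu f >]].

Record L2space := MkL2space { L2val :> T -> R[i]; _ : L2val \in L2pred }.

HB.instance Definition _ := [isSub for L2val].
HB.instance Definition _ := [Choice of L2space by <:].

Lemma L2pred_submod_closed : submod_closed L2pred.
Proof.
split; first by apply/asboolP; exact: L2_0.
move=> a f g /asboolP fL /asboolP gL; apply/asboolP; exact: L2_linear.
Qed.

HB.instance Definition _ :=
  GRing.isSubmodClosed.Build R[i] (T -> R[i]) L2pred L2pred_submod_closed.
HB.instance Definition _ := [SubChoice_isSubLmodule of L2space by <:].

Lemma L2spaceP (u : L2space) : L2 mu u.
Proof. by case: u => f fL; exact/asboolP. Qed.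

Definition toL2 f (fL : L2 mu f) : L2space := MkL2space (asboolT fL).

Definition L2inner (u v : L2space) : R[i] := inner mu u v.

Lemma inner_self f : inner mu f f = (fine (sqnorm mu f))%:C%C.
Proof.
rewrite /inner /cintegral /sqnorm; congr Complex.
  by congr fine; apply: eq_integral => x _; rewrite mul_conjc.
by rewrite /Rintegral integral0_eq// => x _; rewrite mul_conjc.
Qed.

Lemma L2inner_semi : semi_inner L2inner.
Proof.
split.
- move=> a u v w; have [[uL vL] wL] := (L2spaceP u, L2spaceP v, L2spaceP w).
  rewrite /L2inner /inner -cintegralZ -?cintegralD; last 3 first.
  + exact/cintegrableZ/L2_mul_conj.
  + exact: L2_mul_conj.
  + exact: L2_mul_conj.
  congr (cintegral mu _); apply/funext => x.
  by rewrite mulrA -mulrDl.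
- move=> u v; rewrite /L2inner /inner -cintegral_conj; last first.
    exact: L2_mul_conj (L2spaceP u) (L2spaceP v).
  congr (cintegral mu _); apply/funext => x.
  by rewrite conjcM conjcK mulrC.
- move=> u; rewrite /L2inner inner_self ler0c fine_ge0//.
  by apply: integral_ge0 => x _; rewrite lee_fin sqr_ge0.
Qed.

Lemma sqnormE (u : L2space) : sqnorm mu u = (nsq L2inner u)%:E.
Proof.
rewrite /nsq /L2inner inner_self fineK// ge0_fin_numE.
  exact: (L2spaceP u).2.
by apply: integral_ge0 => x _; rewrite lee_fin sqr_ge0.
Qed.

End L2_space.

(** * Integral operators along fast sequences *)

Section domination.
Context d (T : measurableType d) (R : realType).
Variable mu : {measure set T -> \bar R}.

Lemma ae_normc_cintegral_le (h : T -> R[i]) (u : T -> R) (c : R) :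
  cintegrable mu h -> mu.-integrable [set: T] (EFin \o u) ->
  (forall x, 0 <= u x) -> 0 <= c ->
  {ae mu, forall x, normc (h x) <= c * u x} ->
  normc (cintegral mu h) <= c * (2 * \int[mu]_x u x).
Proof.
move=> [h1 h2] iu u0 c0 hu.
have iu_fin := integrable_fin_num measurableT iu.
have part (v : T -> R) : mu.-integrable [set: T] (EFin \o v) ->
    (forall x, `|v x| <= normc (h x)) ->
    `|\int[mu]_x v x| <= c * \int[mu]_x u x.
  move=> iv vh; rewrite -lee_fin EFin_normr_Rintegral// EFinM fineK//.
  apply: (le_trans (le_abse_integral _ measurableT (measurable_int _ iv))).
  rewrite -ge0_integralZl_EFin//; last 2 first.
  - by move=> x _; rewrite lee_fin.
  - exact: measurable_int iu.
  apply: ae_ge0_le_integral => //.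
  - exact/measurableT_comp/(measurable_int _ iv).
  - by move=> x _; rewrite -EFinM lee_fin mulr_ge0.
  - under eq_fun do rewrite -EFinM.
    apply/measurable_EFinP; apply: measurable_funM => //.
    exact/measurable_EFinP/(measurable_int _ iu).
  - apply: filterS hu => x hx _; rewrite -EFinM lee_fin.
    exact: (le_trans (vh x)).
apply: (le_trans (normc_le_Re_Im _)).
rewrite /cintegral /= mulrCA mulr_natl mulr2n lerD//.
- by apply: part => // x; exact: norm_Re_le_normc.
- by apply: part => // x; exact: norm_Im_le_normc.
Qed.


(** Take [g ^ 2 = sum_i 4 ^ i |r_i| ^ 2], which has finite integral because the
[i]-th term contributes at most [2 ^ -(i + 1)]. *)
Lemma L2_geometric_dominated (r : nat -> T -> R[i]) :
  (forall i, L2 mu (r i)) ->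
  (forall i, (sqnorm mu (r i) <= (2 * 8 ^+ i)^-1%:E)%E) ->
  exists g : T -> R, [/\ (forall y, 0 <= g y), L2 mu (fun y => (g y)%:C%C) &
    {ae mu, forall y, forall i, normc (r i y) <= (2^-1) ^+ i * g y}].
Proof.
move=> rL rs.
pose e y := (\sum_(0 <= i <oo) (4 ^+ i * normc (r i y) ^+ 2)%:E)%E.
have term0 i y : (0 <= (4 ^+ i * normc (r i y) ^+ 2)%:E)%E.
  by rewrite lee_fin mulr_ge0 ?sqr_ge0 ?exprn_ge0.
have mterm i : measurable_fun [set: T]
    (fun y => (4 ^+ i * normc (r i y) ^+ 2)%:E).
  apply/measurable_EFinP; apply: measurable_funM => //.
  exact: measurable_normc_sqr (rL i).1.
have e0 y : (0 <= e y)%E by exact: nneseries_ge0.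
have me : measurable_fun [set: T] e by exact: ge0_emeasurable_sum.
have ie : mu.-integrable [set: T] e.
  apply/integrableP; split => //.
  under eq_integral do rewrite gee0_abs//.
  rewrite integral_nneseries//.
  apply: (@le_lt_trans _ _ (\sum_(0 <= i <oo) (1 / (2 ^ (i + 1))%:R)%:E)%E).
    apply: lee_nneseries => [i _ _|i _]; first exact: integral_ge0.
    under eq_integral do rewrite EFinM.
    rewrite ge0_integralZl_EFin ?exprn_ge0//; last 2 first.
    - by move=> x _; rewrite lee_fin sqr_ge0.
    - exact/measurable_EFinP/measurable_normc_sqr/(rL i).1.
    apply: (@le_trans _ _ ((4 ^+ i)%:E * (2 * 8 ^+ i)^-1%:E)%E).
      by apply: lee_wpmul2l; [rewrite lee_fin exprn_ge0|exact: rs].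
    rewrite -EFinM lee_fin addn1 natrX exprS.
    have -> : 8 ^+ i = 2 ^+ i * 4 ^+ i :> R.
      by rewrite -exprMn; congr (_ ^+ _); ring.
    rewrite le_eqVlt; apply/orP; left; apply/eqP.
    by field; rewrite !expf_neq0.
  have /cvg_lim := @cvg_geometric_eseries_half R 1 0.
  by rewrite /eseries => ->//; rewrite ltry.
pose g y := Num.sqrt (fine (e y)).
have gE y : g y ^+ 2 = fine (e y) by rewrite /g sqr_sqrtr// fine_ge0.
exists g; split.
- by move=> y; exact: sqrtr_ge0.
- split.
    split => /=; last exact: measurable_cst.
    apply: (eq_measurable_fun (fun y => fine (e y) `^ 2^-1)).
      by move=> y _; rewrite powR12_sqrt// fine_ge0.
    apply: (measurableT_comp (measurable_powR _)).
    exact: measurableT_comp.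
  apply: (le_lt_trans _ (integrable_lty measurableT ie)).
  apply: ge0_le_integral => //.
  - by move=> y _; rewrite lee_fin sqr_ge0.
  - apply/measurable_EFinP; under eq_fun do rewrite normc_real_sqr gE.
    exact: measurableT_comp.
  - move=> y _; rewrite normc_real_sqr gE.
    by case: (e y) (e0 y) => // *; rewrite leey.
- apply: filterS (integrable_ae measurableT ie) => y /(_ I) ey i.
  have h : 4 ^+ i * normc (r i y) ^+ 2 <= g y ^+ 2.
    rewrite gE -lee_fin fineK//.
    apply: le_trans (nneseries_lim_ge i.+1 _) => //.
    by rewrite big_nat_recr//= leeDr// sume_ge0.
  rewrite exprVn -[_ * g y]mulrC ler_pdivlMr ?exprn_gt0//.
  rewrite -ler_sqr ?nnegrE ?mulr_ge0 ?normc_ge0 ?exprn_ge0 ?sqrtr_ge0//.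
  have E4 : 4 ^+ i = (2 ^+ i) ^+ 2 :> R.
    by rewrite -exprM mulnC exprM; congr (_ ^+ _); ring.
  by move: h; rewrite E4 -exprMn mulrC.
Qed.

End domination.

Section integral_operators.
Context d (T : measurableType d) (R : realType).
Variable mu : {measure set T -> \bar R}.
Variables (k : T * T -> R[i]) (A : (T -> R[i]) -> (T -> R[i])).
Hypothesis hA : integral_operator mu k A.
Implicit Types f g : T -> R[i].

Let hA2 f (fL : L2 mu f) := hA.2 f fL.

Lemma integral_operator_linear : linear_operator mu A.
Proof.
split.
- by move=> f fL; have [] := hA2 fL.
- move=> f g fL gL fg.
  have [_ Af] := hA2 fL; have [_ Ag] := hA2 gL.
  apply: filterS2 Af Ag => t [kf ->] [kg ->].
  apply: ae_eq_cintegral; [exact: cintegrable_cmeasurable kf|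
    exact: cintegrable_cmeasurable kg|].
  by apply: filterS fg => y /= ->.
- move=> a f g fL gL.
  have [_ Af] := hA2 fL; have [_ Ag] := hA2 gL.
  have [_ Afg] := hA2 (L2_linear a fL gL).
  apply: filterS3 Af Ag Afg => t [kf ->] [kg ->] [_ ->].
  rewrite -cintegralZ// -cintegralD//; last exact: cintegrableZ.
  by congr (cintegral mu _); apply/funext => y; ring.
Qed.

(** Absolute convergence stands in for continuity: the integral for [A g], with
[g] the common majorant of the sequence, dominates those for [A (r i)] up to
the factor [2 ^ -i]. *)
Lemma ae_operator_cvg0 (r : nat -> T -> R[i]) :
  (forall i, L2 mu (r i)) ->
  (forall i, (sqnorm mu (r i) <= (2 * 8 ^+ i)^-1%:E)%E) ->
  {ae mu, forall t, normc (A (r i) t) @[i --> \oo] --> (0 : R)}.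
Proof.
move=> rL rs; have [g [g0 gL rg]] := L2_geometric_dominated rL rs.
have [_ Ag] := hA2 gL.
have Ar : {ae mu, forall t, forall i,
    cintegrable mu (fun y => k (t, y) * r i y) /\
    A (r i) t = cintegral mu (fun y => k (t, y) * r i y)}.
  by apply: ae_foralln => i; have [] := hA2 (rL i).
apply: filterS2 Ag Ar => t [kg _] Art.
pose u y := (`|complex.Re (k (t, y))| + `|complex.Im (k (t, y))|) * g y.
have u0 y : 0 <= u y by rewrite mulr_ge0 ?addr_ge0.
have iu : mu.-integrable [set: T] (EFin \o u).
  have [k1 k2] := kg.
  have := integrableD measurableT (integrable_abse k1) (integrable_abse k2).
  apply: eq_integrable => // y _ /=; rewrite -EFinD; congr EFin; rewrite /u.
  case: (k (t, y)) => a b /=; rewrite !mulr0 subr0 add0r !normrM.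
  by rewrite (ger0_norm (g0 y)) mulrDl.
pose M := 2 * \int[mu]_y u y.
have bound i : normc (A (r i) t) <= (2^-1) ^+ i * M.
  have [ki ->] := Art i.
  apply: ae_normc_cintegral_le => //.
  apply: filterS rg => y /(_ i) ry; rewrite normcM /u mulrCA.
  by rewrite ler_pM ?normc_ge0 ?normc_le_Re_Im.
have half1 : `|2^-1 : R| < 1 by rewrite ger0_norm ?invr_ge0// invf_lt1 ?ltr1n.
have lim0 : (2^-1 : R) ^+ i * M @[i --> \oo] --> 0.
  by rewrite -(mul0r M); apply: cvgMl; exact: cvg_expr.
apply: (squeeze_cvgr _ (cvg_cst 0) lim0).
by apply: nearW => i; rewrite normc_ge0 bound.
Qed.

(** [v i] tends to [A f] almost everywhere, so Fatou's lemma applies. *)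
Lemma sqnorm_operator_le (f : T -> R[i]) (v r : nat -> T -> R[i]) (C : R) :
  L2 mu f -> (forall i, L2 mu (v i)) -> (forall i, L2 mu (r i)) ->
  (forall i, (sqnorm mu (r i) <= (2 * 8 ^+ i)^-1%:E)%E) ->
  (forall i, (sqnorm mu (v i) <= C%:E)%E) ->
  (forall i, {ae mu, forall t, A f t = v i t + A (r i) t}) ->
  (sqnorm mu (A f) <= C%:E)%E.
Proof.
move=> fL vL rL rs vC Af; have [AfL _] := hA2 fL.
pose w i t := (normc (v i t) ^+ 2)%:E.
have mw i : measurable_fun [set: T] (w i).
  exact/measurable_EFinP/measurable_normc_sqr/(vL i).1.
have w0 i t : (0 <= w i t)%E by rewrite lee_fin sqr_ge0.
apply: (@le_trans _ _ (\int[mu]_t limn_einf (w ^~ t))%E).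
  have liminf0 t : (0 <= limn_einf (w ^~ t))%E.
    rewrite limn_einf_lim; apply: lime_ge; first exact: is_cvg_einfs.
    by apply: nearW => n; apply: le_ereal_inf_tmp => _ [m _ <-].
  apply: ae_ge0_le_integral => //.
  - by move=> t _; rewrite lee_fin sqr_ge0.
  - exact/measurable_EFinP/measurable_normc_sqr/AfL.1.
  - apply: measurableT_comp => //.
    by apply: measurable_fun_limn_esup => i; exact: measurableT_comp.
  - apply: filterS2 (ae_operator_cvg0 rL rs) (ae_foralln Af) => t Ar0 Aft _.
    have lim : normc (v i t) @[i --> \oo] --> normc (A f t).
      apply/cvgrPdist_le => e e0; move/cvgrPdist_le : Ar0 => /(_ e e0).
      apply: filterS => i; rewrite sub0r normrN ger0_norm ?normc_ge0//.
      apply: le_trans; rewrite ler_norml lerBrDr lerBlDr.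
      have vE : v i t = A f t + - A (r i) t by rewrite (Aft i) addrK.
      apply/andP; split.
        rewrite addrC -lerBrDr opprK addrC.
        by rewrite {1}vE (le_trans (le_normcD _ _))// normcN addrC.
      by rewrite {1}(Aft i) (le_trans (le_normcD _ _))// addrC.
    have lim2 : w i t @[i --> \oo] --> (normc (A f t) ^+ 2)%:E.
      by apply: cvg_EFin; [exact: nearW|rewrite expr2; exact: cvgM].
    by rewrite (cvg_limn_einf_sup lim2).1.
apply: (le_trans (fatou mu measurableT mw (fun i t _ => w0 i t))).
rewrite limn_einf_lim; apply: lime_le; first exact: is_cvg_einfs.
apply: nearW => n; apply: (le_trans _ (vC n)).
by apply: ereal_inf_lbound; exists n => //=.
Qed.

End integral_operators.

(** * Pairings with the kernel *)

Section pairing.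
Context d (T : measurableType d) (R : realType).
Variable mu : {sigma_finite_measure set T -> \bar R}.

(** Tonelli's theorem gives this for nonnegative [u]; the sections of [u] need
not be integrable, as the integral is by definition the difference of those of
the positive and negative parts. *)
Lemma measurable_Rintegral_section (u : T * T -> R) :
  measurable_fun [set: T * T] u ->
  measurable_fun [set: T] (fun t => \int[mu]_y u (t, y)).
Proof.
move=> mu_; apply: measurableT_comp => //=.
have mE : measurable_fun [set: T * T] (EFin \o u) by exact/measurable_EFinP.
under eq_fun do rewrite integralE.
apply: emeasurable_funB.
- have := @measurable_fun_fubini_tonelli_F _ _ T T R mu
    ((EFin \o u)^\+)%E (measurable_funepos mE) (fun z => funepos_ge0 _ z).
  apply: eq_measurable_fun => t _; rewrite /fubini_F.
  by apply: eq_integral => y _; rewrite unlock.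
- have := @measurable_fun_fubini_tonelli_F _ _ T T R mu
    ((EFin \o u)^\-)%E (measurable_funeneg mE) (fun z => funeneg_ge0 _ z).
  apply: eq_measurable_fun => t _; rewrite /fubini_F.
  by apply: eq_integral => y _; rewrite unlock.
Qed.

Lemma cmeasurable_cintegral_section (h : T * T -> R[i]) : cmeasurable h ->
  cmeasurable (fun t => cintegral mu (fun y => h (t, y))).
Proof.
move=> [h1 h2]; split.
  exact: (measurable_Rintegral_section h1).
exact: (measurable_Rintegral_section h2).
Qed.

(** The two integrands agree only for almost every [t], so their equality under
the integral needs both to be measurable. *)
Lemma pairing_tensor (k : T * T -> R[i]) (A : (T -> R[i]) -> (T -> R[i]))
    (f g : T -> R[i]) :
  integral_operator mu k A -> L2 mu f -> L2 mu g ->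
  pairing mu k (tensor f (fun y => conjc (g y))) = inner mu (A g) f.
Proof.
move=> [mk hA] fL gL; have [AgL Ag] := hA _ gL.
have mcomp (s : T * T -> T) (h : T -> R[i]) : measurable_fun [set: T * T] s ->
    cmeasurable h -> cmeasurable (fun z => h (s z)).
  move=> ms [h1 h2].
  by split; [exact: (measurableT_comp h1 ms)|exact: (measurableT_comp h2 ms)].
rewrite /pairing /inner; apply: ae_eq_cintegral.
- apply: (@cmeasurable_cintegral_section
    (fun z => k z * conjc (f z.1 * conjc (g z.2)))).
  apply: cmeasurableM mk _; apply/cmeasurable_conj/cmeasurableM.
    by apply: mcomp fL.1; exact: measurable_fst.
  by apply: mcomp (cmeasurable_conj gL.1); exact: measurable_snd.
- by apply: cmeasurableM AgL.1 _; exact: cmeasurable_conj fL.1.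
apply: filterS Ag => t [kg ->]; rewrite mulrC -cintegralZ//.
congr (cintegral mu _); apply/funext => y.
by rewrite /tensor/= conjcM conjcK; ring.
Qed.

End pairing.

(** * Boundedness of the operator *)

Section operator_on_L2.
Context d (T : measurableType d) (R : realType).
Variable mu : {measure set T -> \bar R}.
Variables (k : T * T -> R[i]) (A : (T -> R[i]) -> (T -> R[i])).
Hypothesis hA : integral_operator mu k A.

Local Notation V := (L2space mu).
Local Notation ip := (@L2inner _ T R mu).
Let ipP : semi_inner ip := L2inner_semi mu.

Definition L2op (u : V) : V := toL2 (hA.2 _ (L2spaceP u)).1.

Lemma L2inner_ae (u u' w : V) : {ae mu, forall t, u t = u' t} ->
  ip u w = ip u' w.
Proof.
move=> uu'; apply: ae_eq_cintegral.
- apply: cmeasurableM (L2spaceP u).1 _; exact: cmeasurable_conj (L2spaceP w).1.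
- apply: cmeasurableM (L2spaceP u').1 _; exact: cmeasurable_conj (L2spaceP w).1.
- by apply: filterS uu' => t /= ->.
Qed.

Lemma L2op_linear_ae (a : R[i]) (u v : V) :
  {ae mu, forall t, L2op (a *: u + v) t = a * L2op u t + L2op v t}.
Proof.
have [_ _ lin] := integral_operator_linear hA.
exact: (lin a u v (L2spaceP u) (L2spaceP v)).
Qed.

Lemma L2op_linear (a : R[i]) (u v w : V) :
  ip (L2op (a *: u + v)) w = a * ip (L2op u) w + ip (L2op v) w.
Proof.
rewrite -(semi_inner_linear ipP); apply: L2inner_ae.
exact: L2op_linear_ae.
Qed.

Lemma L2op0_ae : {ae mu, forall t, L2op 0 t = 0}.
Proof.
have [_] := hA.2 _ (L2spaceP (0 : V)).
apply: filterS => t [k0 At]; apply: (etrans At).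
have -> : (fun y => k (t, y) * (0 : V) y) = (fun y => 0 * (k (t, y) * (0 : V) y)).
  by apply/funext => y; rewrite mul0r -[RHS](mulr0 (k (t, y))).
by rewrite cintegralZ// mul0r.
Qed.

Lemma L2op_comb_ae N (c : nat -> R[i]) (v : nat -> V) :
  {ae mu, forall t, L2op (\sum_(0 <= n < N) c n *: v n) t =
    (\sum_(0 <= n < N) c n *: L2op (v n) : V) t}.
Proof.
elim: N => [|N IH]; first by rewrite !big_geq//; exact: L2op0_ae.
rewrite !big_nat_recr//= ![_ + c N *: _]addrC.
set S := \sum_(0 <= n < N) c n *: v n in IH *.
apply: filterS2 (L2op_linear_ae (c N) (v N) S) IH => t E1 E2.
by apply: (etrans E1); rewrite E2.
Qed.

Lemma L2op_comb N (c : nat -> R[i]) (v : nat -> V) w :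
  ip (L2op (\sum_(0 <= n < N) c n *: v n)) w =
  \sum_(0 <= n < N) c n * ip (L2op (v n)) w.
Proof. by rewrite (L2inner_ae _ (L2op_comb_ae _ _ _)) (ip_combl ipP). Qed.

Section bounded.
Variables (psi : nat -> V) (B1 B2 beta : R).
Hypothesis psiP : frame_bounds ip psi B1 B2.
Hypothesis betaP :
  forall N, \sum_(0 <= n < N) nsq ip (L2op (psi n)) <= beta.

(** Each approximant of [u] is a combination of the [psi n] with bounded
coefficients, so its image is bounded by duality; the residuals are made to
decrease as fast as the closedness argument requires. *)
Lemma L2op_bounded_unit (u : V) : nsq ip u <= 1 ->
  nsq ip (L2op u) <= beta * (4 * B2 / B1) ^+ 2.
Proof.
move=> u1; have beta0 : 0 <= beta by have := betaP 0; rewrite big_geq.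
have e0 i : 0 < (2 * 8 ^+ i : R)^-1 by rewrite invr_gt0 mulr_gt0 ?exprn_gt0.
have ball1 (a : 'I_1 -> R[i]) : unit_ball a -> nsq ip (\sum_j a j *: u) <= 1.
  rewrite /unit_ball/= !big_ord1 (nsqZ ipP) => a1.
  by rewrite mulr_ile1 ?sqr_ge0 ?(nsq_ge0 ipP).
have /choice[N /choice[c hc]] := fun i =>
  frame_approx ipP psiP (e0 i) ball1.
pose s i : V := \sum_(0 <= n < N i) c i ord0 n *: psi n.
pose v i : V := \sum_(0 <= n < N i) c i ord0 n *: L2op (psi n).
rewrite -lee_fin -(sqnormE (L2op u)).
apply: (@sqnorm_operator_le _ _ _ _ _ _ hA u v (fun i => u - s i)).
- exact: L2spaceP.
- by move=> i; exact: L2spaceP.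
- by move=> i; exact: L2spaceP.
- by move=> i; rewrite sqnormE lee_fin; have [+ _ _] := hc i; apply.
- move=> i; rewrite sqnormE lee_fin.
  have [_ /(_ ord0) ci _] := hc i.
  apply: (@le_trans _ _ (beta * \sum_(0 <= n < N i) normc (c i ord0 n) ^+ 2)).
    apply: (nsq_comb_le ipP) => // w.
    apply: (@le_trans _ _ (\sum_(0 <= n < N i)
        nsq ip (L2op (psi n)) * nsq ip w)).
      by apply: ler_sum => n _; rewrite mulrC; exact: cauchy_schwarz.
    by rewrite -mulr_suml ler_wpM2r ?(nsq_ge0 ipP).
  by rewrite ler_wpM2l.
- move=> i; have := L2op_linear_ae 1 (s i) (u - s i).
  rewrite scale1r addrC subrK => h.
  by apply: filterS2 h (L2op_comb_ae (N i) (c i ord0) psi) => t E1 E2;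
    apply: (etrans E1); rewrite E2 mul1r.
Qed.

Lemma L2op_bounded (u : V) (e : R) : 0 < e -> nsq ip u <= e ->
  nsq ip (L2op u) <= e * (beta * (4 * B2 / B1) ^+ 2).
Proof.
move=> e0 ue; pose t := Num.sqrt e.
have t0 : 0 < t by rewrite sqrtr_gt0.
have tE : t ^+ 2 = e by rewrite sqr_sqrtr// ltW.
have u1 : nsq ip (t^-1%:C%C *: u) <= 1.
  by rewrite (nsqZ ipP) normc_real_sqr exprVn tE ler_pdivrMl ?mulr1.
have := L2op_bounded_unit u1; rewrite -(ler_pM2l e0).
apply: le_trans; rewrite -tE -normc_real_sqr -(nsqZ ipP).
have uE : u = t%:C%C *: (t^-1%:C%C *: u) + 0.
  rewrite addr0 scalerA -[_ * _]rmorphM/= mulfV ?gt_eqF//.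
  by rewrite [X in X *: _](_ : _ = 1) ?scale1r.
have opE : {ae mu, forall x, L2op u x = (t%:C%C *: L2op (t^-1%:C%C *: u) : V) x}.
  move: uE; set w := t^-1%:C%C *: u; move: (u) => _ ->.
  by apply: filterS2 (L2op_linear_ae t%:C%C w 0) L2op0_ae => x E1 E2;
    apply: (etrans E1); rewrite E2 addr0.
rewrite /nsq (L2inner_ae _ opE) (semi_inner_sym ipP) (L2inner_ae _ opE).
by rewrite -(semi_inner_sym ipP).
Qed.

End bounded.

End operator_on_L2.

(** * Finite Schatten sums *)

Lemma sqr_le_powR (R : realType) (p b K : R) :
  1 <= p <= 2 -> 0 <= b -> b `^ p <= K -> b ^+ 2 <= (1 + K) * b `^ p.
Proof.
move=> /andP[p1 p2] b0 bK; have bp0 := powR_ge0 b p.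
have [->|bn0] := eqVneq b 0.
  by rewrite expr0n/= mulr_ge0 ?powR_ge0// addr_ge0// (le_trans bp0).
have bp : 0 < b by rewrite lt_neqAle eq_sym bn0.
rewrite mulrDl mul1r -powR_mulrn//.
have [b1|/ltW b1] := leP b 1.
  apply: (@le_trans _ _ (b `^ p)); first by rewrite ger_powR// bp b1.
  by rewrite lerDl mulr_ge0// (le_trans bp0).
apply: (@le_trans _ _ (K * b `^ p)); last by rewrite lerDr.
apply: (@le_trans _ _ (b `^ p * b `^ p)); last by rewrite ler_wpM2r.
rewrite -powRD; last by rewrite bn0 implybT.
by rewrite ler_powR//; lra.
Qed.

Lemma powRD_le (R : realType) (p x y : R) : 0 <= p <= 2 -> 0 <= x -> 0 <= y ->
  (x + y) `^ p <= 4 * (x `^ p + y `^ p).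
Proof.
move=> /andP[p0 p2].
wlog yx : x y / y <= x => [hw x0 y0|x0 y0].
  have [yx|/ltW xy] := leP y x; first exact: hw.
  by rewrite addrC [_ `^ p + _]addrC; exact: hw.
apply: (@le_trans _ _ ((2 * x) `^ p)).
  by rewrite ge0_ler_powR ?nnegrE ?addr_ge0 ?mulr_ge0//; lra.
rewrite powRM//; apply: ler_pM; rewrite ?powR_ge0//.
  rewrite (_ : 4 = 2 `^ 2%:R); first by rewrite ler_powR ?ler1n.
  by rewrite powR_mulrn//; ring.
by rewrite lerDl powR_ge0.
Qed.

Section finite_schatten_sums.
Context d (T : measurableType d) (R : realType).
Variable mu : {measure set T -> \bar R}.
Variables (k : T * T -> R[i]) (A : (T -> R[i]) -> (T -> R[i])).
Hypothesis hA : integral_operator mu k A.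

Local Notation V := (L2space mu).
Local Notation ip := (@L2inner _ T R mu).
Let ipP : semi_inner ip := L2inner_semi mu.

Variables (psi : nat -> V) (B1 B2 p K : R).
Hypothesis psiP : frame_bounds ip psi B1 B2.
Hypothesis p12 : 1 <= p <= 2.

Let b n := Num.sqrt (nsq ip (L2op hA (psi n))).
Hypothesis bK : forall N, \sum_(0 <= n < N) b n `^ p <= K.

(** The vectors [f j] are split into a finite frame expansion [s j], handled by
the interpolation inequality, and a residual, handled by boundedness. The
constant is independent of [J], although the accuracy of the expansion is
not. *)
Lemma schatten_finite_sum_le : exists C, 0 <= C /\
  forall J (f g : 'I_J -> V), orthonormal ip f -> orthonormal ip g ->
    \sum_j normc (ip (L2op hA (f j)) (g j)) `^ p <= C.
Proof.
have /andP[p1 p2] := p12; have p0 : 0 <= p by lra.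
have b0 n : 0 <= b n by exact: sqrtr_ge0.
have bE n : b n ^+ 2 = nsq ip (L2op hA (psi n)).
  by rewrite sqr_sqrtr// (nsq_ge0 ipP).
have K0 : 0 <= K by have := bK 0; rewrite big_geq.
have bK1 n : b n `^ p <= K.
  apply: le_trans (bK n.+1); rewrite big_nat_recr//= lerDr.
  by apply: sumr_ge0 => i _; exact: powR_ge0.
pose beta := (1 + K) * K.
have beta0 : 0 <= beta by rewrite mulr_ge0// addr_ge0.
have betaP N : \sum_(0 <= n < N) nsq ip (L2op hA (psi n)) <= beta.
  apply: (@le_trans _ _ (\sum_(0 <= n < N) (1 + K) * b n `^ p)).
    by apply: ler_sum => n _; rewrite -bE sqr_le_powR.
  by rewrite -mulr_sumr ler_wpM2l// addr_ge0.
pose D := (4 * B2 / B1) ^+ 2.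
have B10 := frame_bounds_gt0 psiP; have B12 := frame_bounds_le psiP.
have D1 : 1 <= D.
  rewrite /D -[leLHS](expr1n _ 2) ler_sqr ?nnegrE//; last first.
    by rewrite divr_ge0 ?(ltW B10)// mulr_ge0// (le_trans (ltW B10)).
  by rewrite ler_pdivlMr// mul1r; lra.
pose M := beta * D.
have D0 : 0 <= D by exact: le_trans ler01 D1.
have M0 : 0 <= M by exact: mulr_ge0.
exists (4 * (4 * D * ((D + 1) * K) + 1)); split.
  by have := mulr_ge0 D0 (mulr_ge0 (addr_ge0 D0 ler01) K0); lra.
move=> J f g of_ og.
(* Accuracy for which the residuals contribute at most one to the sum. *)
pose e : R := ((M + 1) * J.+1%:R ^+ 2)^-1.
have M1 : 0 < M + 1 by rewrite ltr_wpDl.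
have e0 : 0 < e by rewrite invr_gt0 mulr_gt0 ?exprn_gt0.
have ball a : unit_ball a -> nsq ip (\sum_j a j *: f j) <= 1.
  by rewrite (nsq_orthonormal_comb ipP).
have [N [c [res row col]]] := frame_approx ipP psiP e0 ball.
pose s j := \sum_(0 <= n < N) c j n *: psi n.
pose y j n := normc (ip (L2op hA (psi n)) (g j)).
pose S j := \sum_(0 <= n < N) normc (c j n) * y j n.
pose r j := normc (ip (L2op hA (f j - s j)) (g j)).
have split_le j : normc (ip (L2op hA (f j)) (g j)) <= S j + r j.
  have -> : f j = 1 *: s j + (f j - s j) by rewrite scale1r addrC subrK.
  rewrite L2op_linear mul1r (le_trans (le_normcD _ _))// lerD2r.
  rewrite L2op_comb (le_trans (le_normc_sum _ _ _))//.
  by under eq_bigr do rewrite normcM.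
have S0 j : 0 <= S j.
  by apply: sumr_ge0 => n _; rewrite mulr_ge0 ?normc_ge0.
have r0 j : 0 <= r j by exact: normc_ge0.
have r1 j : r j <= J.+1%:R^-1.
  rewrite -ler_sqr ?nnegrE ?invr_ge0//.
  apply: (le_trans (cauchy_schwarz ipP _ _)).
  have -> : nsq ip (g j) = 1 by rewrite /nsq og eqxx.
  rewrite mulr1 (le_trans (L2op_bounded psiP betaP e0 (res j)))//.
  rewrite -/D -/M /e invfM -mulrA mulrCA exprVn ler_piMr ?invr_ge0 ?sqr_ge0//.
  by rewrite mulrC ler_pdivrMr// mul1r lerDl.
have rp j : r j `^ p <= J.+1%:R^-1.
  have r1' : r j <= 1 by rewrite (le_trans (r1 j))// invf_le1// ler1n.
  apply: le_trans (r1 j).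
  have [rj0|rj0] := eqVneq (r j) 0; first by rewrite rj0 powR0// gt_eqF//; lra.
  rewrite -{2}[r j]powRr1// ger_powR// r1' andbT lt_neqAle eq_sym rj0.
  exact: r0.
apply: (@le_trans _ _ (\sum_j 4 * (S j `^ p + r j `^ p))).
  apply: ler_sum => j _; apply: le_trans (powRD_le _ (S0 j) (r0 j)).
    by rewrite ge0_ler_powR ?nnegrE ?addr_ge0 ?normc_ge0.
  by rewrite p0.
rewrite -mulr_sumr ler_pM2l// big_split/= lerD//.
  apply: (sum_powR_sum_mul_le (b := b)) => //.
  - by move=> j n; exact: normc_ge0.
  - by move=> j n; exact: normc_ge0.
  - by move=> n; rewrite bE; exact: bessel.
apply: (@le_trans _ _ (\sum_(j < J) J.+1%:R^-1)); first exact: ler_sum.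
by rewrite sumr_const card_ord -[_ *+ J]mulr_natl ler_pdivrMr// mul1r ler_nat.
Qed.

End finite_schatten_sums.

(** * From countable families to sequences *)

Lemma esum_pickle (R : realType) (I : countType) (a : I -> \bar R) :
  (forall i, (0 <= a i)%E) ->
  (\esum_(i in [set: I]) a i =
   \sum_(0 <= n <oo) oapp a 0%E (pickle_inv n))%E.
Proof.
move=> a0; pose a' n := oapp a 0%E (pickle_inv n).
have a'0 n : (0 <= a' n)%E by rewrite /a'; case: (pickle_inv n).
have -> : (\esum_(i in [set: I]) a i = \esum_(i in [set: I]) a' (pickle i))%E.
  by apply: eq_esum => i _; rewrite /a' pickleK_inv.
rewrite -(@reindex_esum _ _ _ _ (range (@pickle I))); last first.
  by apply: inj_bij => x y _ _; exact: (pcan_inj pickleK_inv).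
rewrite nneseries_esumT// esum_mkcond; apply: eq_esum => n _.
case: ifPn => // nI; rewrite /a'; case E : (pickle_inv n) => [i|]//=.
exfalso; move/negP : nI; apply; rewrite inE; exists i => //.
by have := @pickle_invK I n; rewrite E.
Qed.

Lemma nneseries_partial_ge (R : realType) (u : nat -> R) (l e : R) :
  (forall n, 0 <= u n) -> 0 < e ->
  (l%:E <= \sum_(0 <= n <oo) (u n)%:E)%E ->
  exists N, l <= \sum_(0 <= n < N) u n + e.
Proof.
move=> u0 e0 lu; apply: contrapT => /forallNP h.
suff : (\sum_(0 <= n <oo) (u n)%:E <= (l - e)%:E)%E.
  by move/(le_trans lu); rewrite lee_fin; lra.
apply: lime_le; first by apply: is_cvg_nneseries => n _ _; rewrite lee_fin.
apply: nearW => N; rewrite sumEFin lee_fin.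
by have /negP := h N; rewrite -ltNge; lra.
Qed.

Lemma nneseries_partial_le (R : realType) (u : nat -> R) (N : nat) :
  (forall n, 0 <= u n) ->
  ((\sum_(0 <= n < N) u n)%:E <= \sum_(0 <= n <oo) (u n)%:E)%E.
Proof.
by move=> u0; rewrite -sumEFin; apply: nneseries_lim_ge => n _ _; rewrite lee_fin.
Qed.

Section schatten.
Context d (T : measurableType d) (R : realType) (I : countType).
Variable mu : {sigma_finite_measure set T -> \bar R}.

Local Notation ip := (@L2inner _ T R mu).
Let ipP : semi_inner ip := L2inner_semi mu.

(** The family listed along the codes of its indices; numbers that are not
codes are sent to [0], which changes neither frame sums nor Schatten sums. *)
Definition pickle_family (phi : I -> L2space mu) (n : nat) : L2space mu :=
  oapp phi 0 (pickle_inv n).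

Lemma esum_pickle_family (phi : I -> L2space mu) (F : L2space mu -> R) :
  (forall v, 0 <= F v) -> F 0 = 0 ->
  (\esum_(i in [set: I]) (F (phi i))%:E =
   \sum_(0 <= n <oo) (F (pickle_family phi n))%:E)%E.
Proof.
move=> F0 F00; rewrite esum_pickle => [|i]; last by rewrite lee_fin.
apply: eq_eseriesr => n _; rewrite /pickle_family.
by case: (pickle_inv n) => //=; rewrite F00.
Qed.

Lemma frame_pickle (phi : I -> L2space mu) (B1 B2 : R) :
  0 < B1 -> 0 < B2 ->
  (forall f, L2 mu f ->
      (B1%:E * sqnorm mu f <=
         \esum_(x in [set: I]) (normc (inner mu f (phi x)) ^+ 2)%:E)%E /\
      (\esum_(x in [set: I]) (normc (inner mu f (phi x)) ^+ 2)%:E <=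
         B2%:E * sqnorm mu f)%E) ->
  frame_bounds ip (pickle_family phi) B1 (B1 + B2 + 1).
Proof.
move=> B10 B20 hphi.
have sumE (v : L2space mu) :
    (\esum_(x in [set: I]) (normc (inner mu v (phi x)) ^+ 2)%:E =
     \sum_(0 <= n <oo) (normc (ip v (pickle_family phi n)) ^+ 2)%:E)%E.
  apply: (@esum_pickle_family phi (fun w => normc (ip v w) ^+ 2)).
    by move=> w; exact: sqr_ge0.
  by rewrite (semi_inner_sym ipP) (ip0l ipP) conjc0 normc0 expr0n.
split => //; [lra|lra| |].
- move=> v N; rewrite -lee_fin.
  apply: (le_trans (nneseries_partial_le _ _)); first by move=> n; exact: sqr_ge0.
  rewrite -sumE (le_trans (hphi v (L2spaceP v)).2)// sqnormE -EFinM lee_fin.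
  by rewrite ler_wpM2r ?(nsq_ge0 ipP)//; lra.
- move=> v e e0; apply: nneseries_partial_ge => //.
    by move=> n; exact: sqr_ge0.
  by rewrite -sumE EFinM -sqnormE; exact: (hphi v (L2spaceP v)).1.
Qed.

(** Of the underlying space, the argument uses only that the measure is
sigma-finite, and this only for Tonelli's theorem in the pairing. *)
Theorem schatten_of_frame (phi : I -> T -> R[i]) (k : T * T -> R[i])
    (A : (T -> R[i]) -> (T -> R[i])) (p : R) :
  frame mu phi -> integral_operator mu k A -> 1 <= p <= 2 ->
  ((\esum_(n in [set: I])
      (\esum_(m in [set: I])
         (normc (pairing mu k
            (tensor (phi m) (fun y => conjc (phi n y)))) ^+ 2)%:E)
      `^ (p / 2)) `^ p^-1 < +oo)%E ->
  schatten_class mu p A.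
Proof.
move=> [phiL [B1 [B2 [B10 B20 hphi]]]] hA p12.
have /andP[p1 p2] := p12; have p0 : 0 < p by lra.
have p20 : p / 2 != 0 by rewrite mulf_neq0 ?gt_eqF// invr_neq0.
have pV0 : p^-1 != 0 by rewrite invr_neq0// gt_eqF.
move=> /(lty_poweRy pV0) hK.
pose phi' i := toL2 (phiL i).
pose psi := pickle_family phi'.
have psiP := @frame_pickle phi' B1 B2 B10 B20 hphi.
pose F (v : L2space mu) := (B1 * nsq ip (L2op hA v)) `^ (p / 2).
have F0 v : 0 <= F v by exact: powR_ge0.
have nsq0 : nsq ip (L2op hA 0) = 0.
  have L0 w : ip (L2op hA 0) w = 0.
    rewrite -(ip0l ipP w); apply: L2inner_ae.
    exact: L2op0_ae.
  by rewrite /nsq L0.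
have F00 : F 0 = 0 by rewrite /F nsq0 mulr0 powR0.
have sumF : (\sum_(0 <= n <oo) (F (psi n))%:E < +oo)%E.
  rewrite -esum_pickle_family//; apply: le_lt_trans hK; apply: le_esum => n _.
  rewrite /F -poweR_EFin; apply: gt0_ler_poweR.
  - by rewrite divr_ge0// ltW.
  - rewrite in_itv/= leey andbT lee_fin mulr_ge0 ?(ltW B10)//.
    exact: nsq_ge0 ipP _.
  - rewrite in_itv/= leey andbT; apply: esum_ge0 => m _.
    by rewrite lee_fin sqr_ge0.
  rewrite EFinM -sqnormE; apply: (le_trans (hphi _ (L2spaceP _)).1).
  apply: le_esum => m _; rewrite lee_fin.
  by rewrite (pairing_tensor hA (phiL m) (phiL n)).
pose K := fine (\sum_(0 <= n <oo) (F (psi n))%:E)%E / B1 `^ (p / 2).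
have B1p : 0 < B1 `^ (p / 2) by exact: powR_gt0.
have bK N : \sum_(0 <= n < N) Num.sqrt (nsq ip (L2op hA (psi n))) `^ p <= K.
  have := nneseries_partial_le N (fun n => F0 (psi n)).
  have sum0 : (0 <= \sum_(0 <= n <oo) (F (psi n))%:E)%E.
    by apply: nneseries_ge0 => n _ _; rewrite lee_fin.
  rewrite -[X in (_ <= X)%E]fineK ?ge0_fin_numE// lee_fin => h.
  rewrite /K ler_pdivlMr//; apply: le_trans h.
  rewrite mulr_suml; apply: ler_sum => n _.
  have q0 : 0 <= nsq ip (L2op hA (psi n)) by exact: nsq_ge0 ipP _.
  rewrite /F powRM// ?(ltW B10)// mulrC ler_pM2l//.
  by rewrite -powR12_sqrt// -powRrM mulrC.
have [C [C0 hC]] := schatten_finite_sum_le psiP p12 bK.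
split; first exact: integral_operator_linear hA.
apply: (@le_lt_trans _ _ (C%:E `^ p^-1)%E); last by rewrite poweR_EFin ltry.
apply: ge_ereal_sup => _ [f [g [[fL fo] [gL go] ->]]].
have x0 n : 0 <= normc (inner mu (A (f n)) (g n)) `^ p by exact: powR_ge0.
apply: gt0_ler_poweR.
- by rewrite invr_ge0 ltW.
- by rewrite in_itv/= leey andbT; apply: nneseries_ge0 => n _ _; rewrite lee_fin.
- by rewrite in_itv/= leey andbT lee_fin.
apply: lime_le; first by apply: is_cvg_nneseries => n _ _; rewrite lee_fin.
apply: nearW => J; rewrite sumEFin lee_fin big_mkord.
apply: (hC J (fun j => toL2 (fL j)) (fun j => toL2 (gL j))).
- by move=> i j; exact: fo.
- by move=> i j; exact: go.
Qed.

End schatten.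

Theorem theorem1p1 (R : realType) (d : nat) (I : countType)
  (phi : I -> Rn R d -> R[i])
  (k : Rn R d * Rn R d -> R[i]) (A : (Rn R d -> R[i]) -> (Rn R d -> R[i]))
  (p : R) :
  frame (lebesgue_Rn R d) phi ->
  integral_operator (lebesgue_Rn R d) k A ->
  1 <= p <= 2 ->
  let Phi m n := tensor (phi m) (fun y => conjc (phi n y)) in
  ((\esum_(n in [set: I])
      (\esum_(m in [set: I])
         (normc (pairing (lebesgue_Rn R d) k (Phi m n)) ^+ 2)%:E) `^ (p / 2))
   `^ p^-1 < +oo)%E ->
  schatten_class (lebesgue_Rn R d) p A.
Proof. exact: schatten_of_frame. Qed.
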